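(* Let $\Omega=\mathbb{FP}^{d-1}$ be a projective space of real dimension $D$. For every $s$ with $0\le s<D$, the kernel $K_s$ is strictly positive definite on $\Omega$.
   Context: Projective spaces: $\mathbb{F}\in\{\mathbb{R},\mathbb{C},\mathbb{H},\mathbb{O}\}$, $d\ge 3$ an integer, with $d=3$ when $\mathbb{F}=\mathbb{O}$. $\Omega=\mathbb{FP}^{d-1}$ may be realized as the set of Hermitian $d\times d$ matrices $\Pi$ over $\mathbb{F}$ with $\Pi^2=\Pi$ and $\mathrm{Tr}(\Pi)=1$. It carries its isometry-invariant Riemannian metric, normalized so that the geodesic distance $\vartheta$ takes values in $[0,\frac{\pi}{2}]$ (diameter $\frac\pi2$). The chordal metric is $\rho(x,y)=\sin(\vartheta(x,y))$; in the matrix model $\rho(\Pi_1,\Pi_2)=\sqrt{1-\langle\Pi_1,\Pi_2\rangle}$ with $\langle A,B\rangle=\mathrm{Re}\sum_{i,j}a_{ij}\overline{b_{ij}}$. $D=(d-1)\dim_{\mathbb{R}}(\mathbb{F})$. $K_s(x,y)=\rho(x,y)^{-s}$ for $s>0$; $K_0(x,y)=-\log\rho(x,y)$ (both $+\infty$ on the diagonal). For a finite signed Borel measure $\nu$ on $\Omega$, $I_K(\nu)=\iint_{\Omega\times\Omega}K(x,y)\,d\nu(x)\,d\nu(y)$; it is well defined when the integral exists in the extended sense (its positive and negative parts are not both infinite). A kernel $K$ is positive definite if $I_K(\nu)\ge0$ for every finite signed Borel measure $\nu$ for which the energy is well defined, and strictly positive definite if in addition $I_K(\nu)=0$ only if $\nu=0$.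 *)

(* Defs.v *)
(* Conventions.  The four real normed division algebras are the first four
   steps of the Cayley-Dickson construction over the real numbers.  The space
   FP^n is the set of Hermitian idempotent matrices of size n.+1 and trace 1
   over F, with the topology induced by the matrix space and its Borel sets. *)
From HB Require Import structures.
From mathcomp Require Import all_boot all_order all_algebra.
From mathcomp Require Import all_classical all_reals all_analysis.

Set Implicit Arguments.
Unset Strict Implicit.
Unset Printing Implicit Defensive.

Import Order.TTheory GRing.Theory Num.Theory.
Import numFieldNormedType.Exports.

Local Open Scope classical_set_scope.
Local Open Scope ring_scope.

Inductive division_algebra := Reals | Complexes | Quaternions | Octonions.

Definition cd_level (F : division_algebra) : nat :=
  match F with
  | Reals => 0 | Complexes => 1 | Quaternions => 2 | Octonions => 3
  end.

Definition dimR (F : division_algebra) : nat := (2 ^ cd_level F)%N.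

(* The product type carries the sup norm, which is not the norm of the
   algebra; only the additive group and the topology are used. *)
Fixpoint cd (R : realType) (k : nat) : normedModType R :=
  match k with
  | 0 => R^o
  | k'.+1 => (cd R k' * cd R k')%type
  end.

Fixpoint cd_one (R : realType) (k : nat) : cd R k :=
  match k return cd R k with
  | 0 => (1 : R)
  | k'.+1 => (cd_one R k', 0)
  end.

Fixpoint cd_conj (R : realType) (k : nat) : cd R k -> cd R k :=
  match k return cd R k -> cd R k with
  | 0 => fun x => x
  | k'.+1 => fun x => (cd_conj x.1, - x.2)
  end.

(* (a, b) (c, d) = (a c - d^* b, d a + b c^* ) *)
Fixpoint cd_mul (R : realType) (k : nat) : cd R k -> cd R k -> cd R k :=
  match k return cd R k -> cd R k -> cd R k with
  | 0 => fun x y : R => x * y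
  | k'.+1 => fun x y =>
      (cd_mul x.1 y.1 - cd_mul (cd_conj y.2) x.2,
       cd_mul y.2 x.1 + cd_mul x.2 (cd_conj y.1))
  end.

Fixpoint cd_re (R : realType) (k : nat) : cd R k -> R :=
  match k return cd R k -> R with
  | 0 => fun x => x
  | k'.+1 => fun x => cd_re x.1
  end.

Section ProjectiveSpace.
Variables (R : realType) (F : division_algebra).

Definition alg : normedModType R := cd R (cd_level F).

Definition adjmx (m : nat) (A : 'M[alg]_m) : 'M[alg]_m :=
  \matrix_(i, j) cd_conj (A j i).

(* [mulmx] requires a ring structure on the entries, hence associativity. *)
Definition alg_mulmx (m : nat) (A B : 'M[alg]_m) : 'M[alg]_m :=
  \matrix_(i, j) \sum_l cd_mul (A i l) (B l j).

Definition mxdot (m : nat) (A B : 'M[alg]_m) : R :=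
  cd_re (\sum_i \sum_j cd_mul (A i j) (cd_conj (B i j))).

Definition projectors (n : nat) : set 'M[alg]_n.+1 :=
  [set P | [/\ adjmx P = P, alg_mulmx P P = P & \tr P = cd_one R (cd_level F)]].
Arguments projectors n _ : clear implicits.

Definition projspace (n : nat) : Type := set_type (projectors n).

HB.instance Definition _ n := Topological.copy (projspace n)
  (set_type (projectors n)).

End ProjectiveSpace.
Arguments projectors R F n _ : clear implicits.

Section Point.
Variable R : realType.

Lemma cd_conj0 k : cd_conj (0 : cd R k) = 0.
Proof. by elim: k => //= k ->; rewrite oppr0. Qed.

Lemma cd_conj1 k : cd_conj (cd_one R k) = cd_one R k.
Proof. by elim: k => //= k ->; rewrite oppr0. Qed.

Lemma cd_mul0 k (x : cd R k) : cd_mul 0 x = 0 /\ cd_mul x 0 = 0.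
Proof.
elim: k x => [|k IH] x /=; first by split; [exact: mul0r|exact: mulr0].
have l y := (IH y).1; have r y := (IH y).2.
by rewrite !cd_conj0 !l !r !subr0 !addr0.
Qed.

Lemma cd_mul11 k : cd_mul (cd_one R k) (cd_one R k) = cd_one R k.
Proof.
elim: k => [|k IH] /=; first exact: mulr1.
by rewrite IH !(cd_mul0 _).1 !(cd_mul0 _).2 subr0 addr0.
Qed.

Definition pt_mx F n : 'M[alg R F]_n.+1 :=
  \matrix_(i, j)
    if (i == ord0) && (j == ord0) then cd_one R (cd_level F) else 0.

Lemma pt_mxP F n : pt_mx F n \in projectors R F n.
Proof.
rewrite inE; split.
- apply/matrixP => i j; rewrite !mxE andbC.
  by case: ifP => _; rewrite ?cd_conj0 ?cd_conj1.
- apply/matrixP => i j; rewrite !mxE (bigD1 ord0)//= big1 ?addr0.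
    rewrite !mxE eqxx andbT /=; case: eqP => _ /=; case: eqP => _ /=;
    by rewrite ?cd_mul11 ?(cd_mul0 _).1 ?(cd_mul0 _).2.
  by move=> l /negbTE l0; rewrite !mxE l0 andbF (cd_mul0 _).1.
- rewrite /mxtrace (bigD1 ord0)//= big1 ?addr0 ?mxE ?eqxx//.
  by move=> l /negbTE l0; rewrite !mxE l0.
Qed.

HB.instance Definition _ F n :=
  isPointed.Build (projspace R F n) (SigSub (pt_mxP F n)).

End Point.

Section Kernels.
Variables (R : realType) (F : division_algebra) (n : nat).

Definition borel_projspace :=
  g_sigma_algebraType (@open (projspace R F n)).

(* The sine of the geodesic distance, in the matrix model. *)
Definition chordal (x y : borel_projspace) : R :=
  Num.sqrt (1 - mxdot (set_val x) (set_val y)).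

Definition riesz_kernel (s : R) (x y : borel_projspace) : \bar R :=
  if x == y then +oo%E
  else if s == 0 then (- ln (chordal x y))%:E
  else (chordal x y `^ (- s))%:E.

End Kernels.

Section Energy.
Variables (disp : measure_display) (T : measurableType disp) (R : realType).
Implicit Types (K : T -> T -> \bar R) (nu : {charge set T -> \bar R}).

Definition hahn_pos nu : set T := projT1 (cid (Hahn_decomposition nu)).

Definition hahn_neg nu : set T :=
  projT1 (cid (projT2 (cid (Hahn_decomposition nu)))).

Lemma hahn_posneg nu : hahn_decomposition nu (hahn_pos nu) (hahn_neg nu).
Proof. exact: projT2 (cid (projT2 (cid (Hahn_decomposition nu)))). Qed.

Definition pos_part nu : {finite_measure set T -> \bar R} :=
  jordan_pos (hahn_posneg nu).

Definition neg_part nu : {finite_measure set T -> \bar R} :=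
  jordan_neg (hahn_posneg nu).

Local Open Scope ereal_scope.

Definition mutual_energy (G : T * T -> \bar R)
    (m1 m2 : {finite_measure set T -> \bar R}) : \bar R :=
  \int[(m1 \x m2)%E]_z G z.

(* The Jordan decomposition of the product charge of nu with itself is
   (nu+ x nu+ + nu- x nu-) - (nu+ x nu- + nu- x nu+). *)
Definition energy_pos K nu : \bar R :=
  let Kp := (fun z => K z.1 z.2)^\+ in
  let Kn := (fun z => K z.1 z.2)^\- in
  mutual_energy Kp (pos_part nu) (pos_part nu)
  + mutual_energy Kp (neg_part nu) (neg_part nu)
  + mutual_energy Kn (pos_part nu) (neg_part nu)
  + mutual_energy Kn (neg_part nu) (pos_part nu).

Definition energy_neg K nu : \bar R :=
  let Kp := (fun z => K z.1 z.2)^\+ in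
  let Kn := (fun z => K z.1 z.2)^\- in
  mutual_energy Kp (pos_part nu) (neg_part nu)
  + mutual_energy Kp (neg_part nu) (pos_part nu)
  + mutual_energy Kn (pos_part nu) (pos_part nu)
  + mutual_energy Kn (neg_part nu) (neg_part nu).

Definition energy_defined K nu : Prop :=
  ~ (energy_pos K nu = +oo /\ energy_neg K nu = +oo).

Definition energy K nu : \bar R := energy_pos K nu - energy_neg K nu.

Definition positive_definite K : Prop :=
  forall nu, energy_defined K nu -> 0 <= energy K nu.

(* A charge is a function on all sets, of which only the values on measurable
   sets are meaningful. *)
Definition strictly_positive_definite K : Prop :=
  positive_definite K /\
  forall nu, energy_defined K nu -> energy K nu = 0 ->
    forall A, measurable A -> nu A = 0.

End Energy.

(* Main.v *)
Require Import Defs.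
From mathcomp Require Import all_boot all_order all_algebra.
From mathcomp Require Import all_classical all_reals all_analysis.
From mathcomp Require Import measurable_realfun ring lra.

Set Implicit Arguments.
Unset Strict Implicit.
Unset Printing Implicit Defensive.

Import Order.TTheory GRing.Theory Num.Theory.
Import numFieldNormedType.Exports.

Local Open Scope classical_set_scope.
Local Open Scope ring_scope.

(** Write t for the inner product of two projectors x and y. The kernel is
    K_0 = - log(1 - t) / 2, or K_s = (1 - t)^(-s/2) = exp (s K_0), and both
    expand in powers of t with nonnegative coefficients: this is clear for
    - log(1 - t), and composing with exp preserves it.  In real coordinates
    phi_i of the space of Hermitian matrices, t^k is the sum of m(x) m(y) over
    the words m of length k in the phi_i, so the energy of t^k for a signed
    measure is the sum of the squares of its moments of degree k.  Hence the
    energy of the kernel is a nonnegative combination of squares of moments.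
    All that is used of the projective space is that its points have norm 1
    (trace of an idempotent of trace 1) and lie on the hyperplane trace = 1.

    Two points need an argument.  The first is the passage to the limit, since
    the energy is a difference of two possibly infinite integrals and the
    partial sums are not monotone where t < 0.  They are however bounded below,
    and dominated by an affine function of the kernel.  If the positive part of
    the energy is finite, nonnegativity of the energies of the partial sums
    bounds their mixed integrals, Fatou's lemma makes the negative part finite
    ([signed_energy_limit]), and dominated convergence then applies everywhere.

    The second is strictness.  Each moment of positive degree occurs with a
    positive coefficient, so zero energy kills them all, and the moment of
    degree 0 as well because trace = 1 makes the constant 1 a combination of
    coordinates ([signed_moments_eq0]).  A signed measure whose moments vanish
    is zero ([moments_determine_measure]): the bounded functions f such that
    multiplication by f preserves orthogonality to all polynomials form an
    algebra closed under bounded pointwise limits, so the sets whose indicator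
    is of this kind form a sigma-algebra.  It contains the sets phi_i > b,
    because polynomials in phi_i converge boundedly to their indicators, and
    these sets generate the Borel sets. *)

(** * The logarithmic kernel and its power series *)

Section LogSeries.
Variable R : realType.
Implicit Types (t : R) (N : nat).

Definition half_log t : R := - ln (Num.sqrt (1 - t)).

Definition half_log_series N t : R :=
  \sum_(k < N) k.+1%:R^-1 / 2 * t ^+ k.+1.

Lemma half_logE t : t < 1 -> half_log t = - ln (1 - t) / 2.
Proof.
move=> t1; have p : 0 < 1 - t by rewrite subr_gt0.
have sp : 0 < Num.sqrt (1 - t) by rewrite sqrtr_gt0.
rewrite /half_log -[in RHS](sqr_sqrtr (ltW p)) lnXn//.
by rewrite -mulr_natr; lra.
Qed.

(** The remainder vanishes at 0 and has derivative t ^ N / (1 - t) / 2, a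
    geometric sum, so the mean value theorem applies on the segment [0, t]. The
    sign of c, that of t, makes the remainder nonnegative for 0 <= t. *)
Lemma half_log_remainder N t : `|t| < 1 ->
  exists2 c, (- `|t| <= c <= `|t|) && (0 <= c * t) &
    half_log t - half_log_series N t = c ^+ N / (1 - c) / 2 * t.
Proof.
move=> t1.
pose F (x : R) : R := - ln (1 - x) / 2 - half_log_series N x.
pose dF (x : R) : R := x ^+ N / (1 - x) / 2.
have dFP (x : R) : x < 1 -> is_derive x 1 F (dF x).
  move=> x1; have p : 0 < 1 - x by rewrite subr_gt0.
  have d1 : is_derive x 1 (fun x : R => - ln (1 - x) / 2) ((1 - x)^-1 / 2).
    have dc : is_derive x 1 (fun x : R => 1 - x) (-1).
      have := is_deriveB (is_derive_cst (1 : R) x 1) (@is_derive_id R R x 1).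
      by rewrite sub0r.
    have := @is_derive1_comp R (@ln R) (fun x : R => 1 - x) x _ _ (is_derive1_ln p) dc.
    move=> dl; have dlN := is_deriveN dl.
    have := is_deriveZ (2^-1) dlN.
    rewrite (_ : _ \*: _ = fun x : R => - ln (1 - x) / 2); last first.
      by apply/funext => y; rewrite /= mulrC.
    by rewrite mulrN1 opprK /GRing.scale/= mulrC.
  have d2 : is_derive x 1 (half_log_series N) ((\sum_(k < N) x ^+ k) / 2).
    rewrite mulr_suml.
    rewrite (_ : half_log_series N =
      \sum_(k < N) (fun x : R => k.+1%:R^-1 / 2 * x ^+ k.+1)); last first.
      by apply/funext => y; rewrite /half_log_series fct_sumE.
    apply: is_derive_sum => k.
    have := is_deriveZ (k.+1%:R^-1 / 2) (is_deriveX k.+1 (@is_derive_id R R x 1)).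
    rewrite (_ : _ \*: _ = fun x : R => k.+1%:R^-1 / 2 * x ^+ k.+1); last first.
      by apply/funext => y; rewrite /= exprfctE.
    move=> h; apply: (is_derive_eq h).
    have k0 : k.+1%:R != 0 :> R by rewrite pnatr_eq0.
    by rewrite /GRing.scale/= mulr1; set m := _%:R in k0 *; field.
  have := is_deriveB d1 d2.
  rewrite (_ : _ - _ = F)// => h; apply: (is_derive_eq h).
  rewrite /dF -mulrBl; congr (_ / 2).
  have q : 1 - x != 0 by rewrite gt_eqF.
  apply: (mulIf q); rewrite mulrBl mulVf// divfK//.
  have := subrX1 x N; lra.
have F0 : F 0 = 0.
  rewrite /F subr0 ln1 oppr0 mul0r /half_log_series big1 ?subrr// => k _.
  by rewrite expr0n mulr0.
have FE : half_log t - half_log_series N t = F t.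
  by rewrite /F half_logE// (le_lt_trans (ler_norm _) t1).
have cF a b : b < 1 -> {within `[a, b], continuous F}.
  move=> b1; apply: continuous_in_subspaceT => x; rewrite inE/= in_itv/= => /andP[_ xb].
  have /@ex_derive := dFP x (le_lt_trans xb b1).
  by move=> /derivable1_diffP/differentiable_continuous.
rewrite FE; have [t0|t0] := leP 0 t.
  rewrite ger0_norm// in t1 *.
  have [| |c] := @MVT_segment R F dF 0 t t0; last 1 first.
  - rewrite in_itv/= F0 !subr0 => /andP[c0 ct] ->; exists c => //.
    by rewrite ct mulr_ge0// (le_trans _ c0)// oppr_le0.
  - move=> x; rewrite in_itv/= => /andP[_ xt]; apply: dFP; exact: lt_trans xt t1.
  - exact: cF.
rewrite ltr0_norm// in t1 *.
have [| |c] := @MVT_segment R F dF t 0 (ltW t0); last 1 first.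
- rewrite in_itv/= F0 !sub0r mulrN => /andP[tc c0] /oppr_inj ->; exists c => //.
  have ctN : c <= - t by lra.
  by rewrite opprK tc ctN/= mulr_le0// ltW.
- move=> x; rewrite in_itv/= => /andP[_ xt]; apply: dFP; exact: lt_trans xt ltr01.
- exact: cF ltr01.
Qed.

(** For 0 <= t the partial sums increase to [half_log t]. For t < 0 they
    are not monotone, but they stay within 1/2 of [half_log t], itself within
    1/2 of 0; the constants 1 absorb this range. *)
Lemma half_log_series_bounds N t : `|t| < 1 ->
  -1 <= half_log_series N t <= half_log t + 1.
Proof.
move=> t1; have [c /andP[/andP[c1 c2] ct] E] := half_log_remainder N t1.
have [t0|t0] := leP 0 t.
  have c0 : 0 <= c.
    move: t0; rewrite le0r => /orP[/eqP t0|t0]; last by rewrite -(pmulr_lge0 _ t0).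
    by rewrite (le_trans _ c1)// t0 normr0 oppr0.
  have r0 : 0 <= c ^+ N / (1 - c) / 2 * t.
    rewrite !mulr_ge0// ?exprn_ge0// invr_ge0// subr_ge0.
    exact: le_trans c2 (ltW t1).
  have : 0 <= half_log_series N t.
    by apply: sumr_ge0 => k _; rewrite !mulr_ge0// ?invr_ge0 ?exprn_ge0.
  lra.
have c0 : c <= 0 by rewrite -(nmulr_lge0 _ t0).
have tN : `|t| = - t by rewrite ltr0_norm.
have h1 : half_log t <= 0.
  rewrite half_logE; last by rewrite (lt_trans t0).
  have : 0 <= ln (1 - t) by apply: ln_ge0; lra.
  lra.
have h2 : - 2^-1 <= half_log t.
  rewrite half_logE; last by rewrite (lt_trans t0).
  have : ln (1 - t) <= - t by apply: le_ln1Dx; lra.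
  lra.
have q : 1 <= `|1 - c| by rewrite ger0_norm; lra.
have : `|c ^+ N / (1 - c) / 2 * t| <= 2^-1.
  rewrite !normrM [`|2^-1|]ger0_norm// normrX normfV.
  have a1 : `|c| ^+ N / `|1 - c| <= 1.
    rewrite mulr_ile1 ?invr_ge0 ?exprn_ge0 ?exprn_ile1// ?ler_norml
      ?(invf_le1 (lt_le_trans ltr01 q))//; lra.
  have a0 : 0 <= `|c| ^+ N / `|1 - c| by rewrite mulr_ge0 ?invr_ge0 ?exprn_ge0.
  have := normr_ge0 t; nra.
rewrite -E ler_norml; lra.
Qed.

Lemma half_log_series_cvg t : `|t| < 1 ->
  half_log_series N t @[N --> \oo] --> half_log t.
Proof.
move=> t1; apply/cvgrPdist_le => e e0.
have : (2^-1 / (1 - `|t|)) * `|t| ^+ N @[N --> \oo] --> (2^-1 / (1 - `|t|)) * 0.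
  by apply: cvgMr; apply: cvg_expr; rewrite normr_id.
rewrite mulr0 => /cvgrPdist_le /(_ _ e0); apply: filterS => N.
rewrite sub0r normrN ger0_norm; last first.
  by rewrite !mulr_ge0// ?exprn_ge0// invr_ge0 subr_ge0 ltW.
apply: le_trans.
have [c /andP[/andP[c1 c2] ct] ->] := half_log_remainder N t1.
have cn : `|c| <= `|t| by rewrite ler_norml c1 c2.
rewrite !normrM normrX normfV [`|2^-1|]ger0_norm//.
rewrite [leRHS](_ : _ = `|t| ^+ N * (1 - `|t|)^-1 / 2 * 1); last by lra.
have p : 0 < 1 - `|t| by rewrite subr_gt0.
have p2 : 1 - `|t| <= `|1 - c| by rewrite (le_trans _ (ler_norm _))//; lra.
rewrite !ler_pM ?mulr_ge0 ?exprn_ge0 ?invr_ge0//.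
- by rewrite lerXn2r ?nnegrE.
- by rewrite lef_pV2// posrE; lra.
- exact: ltW.
Qed.

Lemma half_log_series1_cvg : half_log_series N (1 : R) @[N --> \oo] --> +oo.
Proof.
have h N : half_log_series N 1 = 2^-1 * series (@harmonic R) N.
  rewrite /half_log_series /series/= mulr_sumr big_mkord.
  by apply: eq_bigr => k _; rewrite expr1n mulr1 mulrC.
have nd : nondecreasing_seq (series (@harmonic R)).
  by apply: nondecreasing_series => k _ _; exact: harmonic_ge0.
have /cvgryPge dv := nondecreasing_dvgn_lt nd (@dvg_harmonic R).
apply/cvgryPge => A; apply: filterS (dv (2 * A)) => N; rewrite h; lra.
Qed.

End LogSeries.

(** * Bounded measurable functions *)

Section BoundedMeasurable.
Context d (T : measurableType d) (R : realType).
Implicit Types (f g h : T -> R).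

Definition bounded_measurable f :=
  measurable_fun setT f /\ exists C, forall x, `|f x| <= C.

Lemma bounded_measurable_cst c : bounded_measurable (fun=> c).
Proof. by split; [exact: measurable_cst | exists `|c|]. Qed.

Lemma bounded_measurableD f g : bounded_measurable f -> bounded_measurable g ->
  bounded_measurable (fun x => f x + g x).
Proof.
move=> [mf [C fC]] [mg [D gD]]; split; first exact: measurable_funD.
by exists (C + D) => x; rewrite (le_trans (ler_normD _ _))// lerD.
Qed.

Lemma bounded_measurableM f g : bounded_measurable f -> bounded_measurable g ->
  bounded_measurable (fun x => f x * g x).
Proof.
move=> [mf [C fC]] [mg [D gD]]; split; first exact: measurable_funM.
by exists (C * D) => x; rewrite normrM ler_pM.
Qed.

Lemma bounded_measurableZ c f : bounded_measurable f ->
  bounded_measurable (fun x => c * f x).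
Proof. exact/bounded_measurableM/bounded_measurable_cst. Qed.

Lemma bounded_measurableX n f : bounded_measurable f ->
  bounded_measurable (fun x => f x ^+ n).
Proof.
move=> bf; elim: n => [|n IH].
  by under eq_fun do rewrite expr0; exact: bounded_measurable_cst.
by under eq_fun do rewrite exprS; exact: bounded_measurableM.
Qed.

Lemma bounded_measurable_sum (I : Type) (s : seq I) (f : I -> T -> R) :
  (forall i, bounded_measurable (f i)) ->
  bounded_measurable (fun x => \sum_(i <- s) f i x).
Proof.
move=> bf; elim: s => [|i s IH].
  by under eq_fun do rewrite big_nil; exact: bounded_measurable_cst.
by under eq_fun do rewrite big_cons; exact: bounded_measurableD.
Qed.

Lemma bounded_measurable_lim (f_ : (T -> R)^nat) f C :
  (forall n, measurable_fun setT (f_ n)) -> (forall n x, `|f_ n x| <= C) ->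
  (forall x, f_ n x @[n --> \oo] --> f x) -> bounded_measurable f.
Proof.
move=> mf fC ff; split.
  by apply: (measurable_fun_cvg mf) => x _; exact: ff.
exists C => x; have cf : `|f_ n x| @[n --> \oo] --> `|f x| by apply: cvg_norm; exact: ff.
rewrite -(cvg_lim _ cf)//; apply: limr_le; first by apply/cvg_ex; eexists; exact: cf.
by apply: nearW => n; exact: fC.
Qed.

Variable m : {measure set T -> \bar R}.
Hypothesis m_fin : (m setT < +oo)%E.

Lemma bounded_measurable_integrable f :
  bounded_measurable f -> m.-integrable setT (EFin \o f).
Proof.
move=> [mf [C fC]]; apply: measurable_bounded_integrable => //.
exists C; split; first exact: num_real.
by move=> M CM x _ /=; rewrite (le_trans (fC x))// ltW.
Qed.

Lemma Rintegral_bounded_cvg (f_ : (T -> R)^nat) f C :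
  (forall n, measurable_fun setT (f_ n)) -> (forall n x, `|f_ n x| <= C) ->
  (forall x, f_ n x @[n --> \oo] --> f x) ->
  Rintegral m setT (f_ n) @[n --> \oo] --> Rintegral m setT f.
Proof.
move=> mf fC ff; have bf := bounded_measurable_lim mf fC ff.
have bC := bounded_measurable_cst C.
have [] := @dominated_convergence _ _ _ m setT measurableT
   (fun n => EFin \o f_ n) (EFin \o f) (fun=> C%:E).
- by move=> n; exact/measurable_EFinP.
- by apply/measurable_EFinP; case: bf.
- by apply: aeW => x _; apply: cvg_EFin; [exact: nearW|exact: ff].
- exact: (bounded_measurable_integrable bC).
- by apply: aeW => x n _ /=; rewrite lee_fin.
move=> i1 _ i3; apply: fine_cvg; rewrite fineK; first exact: i3.
exact: integrable_fin_num.
Qed.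

End BoundedMeasurable.

Section ProductIntegral.
Context d (T : measurableType d) (R : realType).
Variables m1 m2 : {finite_measure set T -> \bar R}.

Lemma product_finite : ((m1 \x m2) setT < +oo)%E.
Proof.
rewrite -setXTT product_measure1E// lte_mul_pinfty//.
  exact: fin_num_measure.
by rewrite ltey_eq fin_num_measure.
Qed.

Lemma bounded_measurable_tensor (h k : T -> R) :
  bounded_measurable h -> bounded_measurable k ->
  bounded_measurable (fun z : T * T => h z.1 * k z.2).
Proof.
move=> [mh [C hC]] [mk [D kD]]; apply: bounded_measurableM; split.
- exact: measurableT_comp.
- by exists C => z; exact: hC.
- exact: measurableT_comp.
- by exists D => z; exact: kD.
Qed.

Lemma Rintegral_tensor (h k : T -> R) :
  bounded_measurable h -> bounded_measurable k ->
  Rintegral (m1 \x m2)%E setT (fun z => h z.1 * k z.2) =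
  Rintegral m1 setT h * Rintegral m2 setT k.
Proof.
move=> bh bk; have bhk := bounded_measurable_tensor bh bk.
have f1 : (m1 setT < +oo)%E by rewrite ltey_eq fin_num_measure.
have f2 : (m2 setT < +oo)%E by rewrite ltey_eq fin_num_measure.
have ik := bounded_measurable_integrable f2 bk.
have ih := bounded_measurable_integrable f1 bh.
have kfin : (\int[m2]_y (k y)%:E)%E \is a fin_num by exact: integrable_fin_num.
rewrite /Rintegral -(integral12_prod_meas1 (bounded_measurable_integrable product_finite bhk)).
transitivity (fine (\int[m1]_x ((h x)%:E * \int[m2]_y (k y)%:E)%E)).
  congr fine; apply: eq_integral => x _; rewrite /fubini_F/=.
  by under eq_integral do rewrite EFinM; rewrite integralZl.
rewrite -(fineK kfin).
rewrite integralZr// fineM//=.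
exact: integrable_fin_num.
Qed.

End ProductIntegral.

(** * Finite-rank positive semidefinite kernels *)

Section PositiveSemidefinite.
Context d (T : measurableType d) (R : realType).
Implicit Types (f g : T * T -> R) (h : T -> R).

(** Kernels that are a finite sum of h(x) h(y). Building the sum one term at
    a time makes the stability under sums and products, and the sign of the
    energy, inductions on the number of terms. *)
Inductive feature_kernel : (T * T -> R) -> Prop :=
| feature_kernel0 : feature_kernel (fun=> 0)
| feature_kernelS h f : bounded_measurable h -> feature_kernel f ->
    feature_kernel (fun z => h z.1 * h z.2 + f z).

Lemma feature_kernel_bounded_measurable f :
  feature_kernel f -> bounded_measurable f.
Proof.
elim=> [|h k bh _ IH]; first exact: bounded_measurable_cst.
by apply: bounded_measurableD IH; exact: bounded_measurable_tensor.
Qed.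

Lemma feature_kernel_tensor h : bounded_measurable h ->
  feature_kernel (fun z => h z.1 * h z.2).
Proof.
move=> bh; have := feature_kernelS bh feature_kernel0.
by under eq_fun do rewrite addr0.
Qed.

Lemma feature_kernelD f g : feature_kernel f -> feature_kernel g ->
  feature_kernel (fun z => f z + g z).
Proof.
move=> kf kg; elim: kf => [|h k bh _ IH].
  by under eq_fun do rewrite add0r.
by under eq_fun do rewrite -addrA; exact: feature_kernelS.
Qed.

Lemma feature_kernelZ c f : 0 <= c -> feature_kernel f ->
  feature_kernel (fun z => c * f z).
Proof.
move=> c0; elim=> [|h k bh _ IH].
  by under eq_fun do rewrite mulr0; exact: feature_kernel0.
rewrite (_ : (fun z => _) = fun z : T * T =>
  (Num.sqrt c * h z.1) * (Num.sqrt c * h z.2) + c * k z).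
  exact: (feature_kernelS (bounded_measurableZ _ bh) IH).
apply/funext => z; rewrite mulrACA -expr2 sqr_sqrtr//; ring.
Qed.

Lemma feature_kernel_cst c : 0 <= c -> feature_kernel (fun=> c).
Proof.
move=> c0; have := feature_kernelZ c0
  (feature_kernel_tensor (bounded_measurable_cst T (1 : R))).
by under eq_fun do rewrite !mulr1.
Qed.

(** The Schur product theorem: the product of the tensor squares of h and h'
    is the tensor square of h h'. *)
Lemma feature_kernelM f g : feature_kernel f -> feature_kernel g ->
  feature_kernel (fun z => f z * g z).
Proof.
move=> kf kg; elim: kf => [|h k bh _ IH].
  by under eq_fun do rewrite mul0r; exact: feature_kernel0.
under eq_fun do rewrite mulrDl; apply: feature_kernelD IH.
elim: kg => [|h' k' bh' _ IH'].
  by under eq_fun do rewrite mulr0; exact: feature_kernel0.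
rewrite (_ : (fun z => _) = fun z : T * T =>
  (h z.1 * h' z.1) * (h z.2 * h' z.2) + h z.1 * h z.2 * k' z).
  exact: (feature_kernelS (bounded_measurableM bh bh') IH').
by apply/funext => z; ring.
Qed.

Lemma feature_kernelX n f : feature_kernel f ->
  feature_kernel (fun z => f z ^+ n).
Proof.
move=> kf; elim: n => [|n IH].
  by under eq_fun do rewrite expr0; exact: feature_kernel_cst.
by under eq_fun do rewrite exprS; exact: feature_kernelM.
Qed.

Lemma feature_kernel_sum (I : Type) (s : seq I) (F : I -> T * T -> R) :
  (forall i, feature_kernel (F i)) ->
  feature_kernel (fun z => \sum_(i <- s) F i z).
Proof.
move=> kF; elim: s => [|i s IH].
  by under eq_fun do rewrite big_nil; exact: feature_kernel0.
by under eq_fun do rewrite big_cons; exact: feature_kernelD.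
Qed.

Variables mu nu : {finite_measure set T -> \bar R}.

(** The energy of the signed measure mu - nu, for kernels whose integrals
    are finite. *)
Definition signed_energy f : R :=
  Rintegral (mu \x mu)%E setT f + Rintegral (nu \x nu)%E setT f
  - (Rintegral (mu \x nu)%E setT f + Rintegral (nu \x mu)%E setT f).

Definition signed_integral h : R := Rintegral mu setT h - Rintegral nu setT h.

Lemma signed_energy_tensor h : bounded_measurable h ->
  signed_energy (fun z => h z.1 * h z.2) = signed_integral h ^+ 2.
Proof.
by move=> bh; rewrite /signed_energy !Rintegral_tensor// /signed_integral; ring.
Qed.

Lemma signed_energyD f g : bounded_measurable f -> bounded_measurable g ->
  signed_energy (fun z => f z + g z) = signed_energy f + signed_energy g.
Proof.
move=> bf bg; rewrite /signed_energy !RintegralD//; first ring;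
  by apply: bounded_measurable_integrable => //; exact: product_finite.
Qed.

Lemma signed_energyZ c f : bounded_measurable f ->
  signed_energy (fun z => c * f z) = c * signed_energy f.
Proof.
move=> bf; rewrite /signed_energy !RintegralZl//; first ring;
  by apply: bounded_measurable_integrable => //; exact: product_finite.
Qed.

Lemma signed_energy_feature_kernel f : feature_kernel f -> 0 <= signed_energy f.
Proof.
elim=> [|h k bh kk IH].
  rewrite /signed_energy /Rintegral !integral_cst//= ?mul0e /=.
  by rewrite !addr0 subr0.
rewrite signed_energyD ?signed_energy_tensor//; last 2 first.
- exact: bounded_measurable_tensor.
- exact: feature_kernel_bounded_measurable.
by rewrite addr_ge0// sqr_ge0.
Qed.

Lemma signed_energy_bounded_cvg (f_ : (T * T -> R)^nat) f C :
  (forall n, measurable_fun setT (f_ n)) -> (forall n x, `|f_ n x| <= C) ->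
  (forall x, f_ n x @[n --> \oo] --> f x) ->
  signed_energy (f_ n) @[n --> \oo] --> signed_energy f.
Proof.
move=> mf fC ff; apply: cvgB; apply: cvgD;
  by apply: (Rintegral_bounded_cvg _ mf fC ff); exact: product_finite.
Qed.

(** In 1 + f + f ^ 2 / 2 + ... the term f already contains c h(x) h(y), by
    hypothesis with a positive semidefinite complement, and all the other terms
    have nonnegative energy. The exponential series of the bounded function f
    converges boundedly, so the estimate for the partial sums passes to the
    limit. *)
Lemma signed_energy_expR f h c : feature_kernel f -> 0 <= c ->
  bounded_measurable h ->
  feature_kernel (fun z => f z - c * (h z.1 * h z.2)) ->
  c * signed_integral h ^+ 2 <= signed_energy (expR \o f).
Proof.
move=> kf c0 bh kfh.
have [mf [C fC]] := feature_kernel_bounded_measurable kf.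
pose S n z : R := series (exp_coeff (f z)) n.
have SE n z : S n z = \sum_(k < n) f z ^+ k / k`!%:R by rewrite /S /series/= big_mkord.
have bS n : bounded_measurable (S n).
  rewrite (_ : S n = fun z => \sum_(k < n) f z ^+ k / k`!%:R); last exact/funext.
  apply: bounded_measurable_sum => k; apply: bounded_measurableM.
    by apply: bounded_measurableX; split => //; exists C.
  exact: bounded_measurable_cst.
have SC n z : `|S n z| <= expR C.
  rewrite SE (le_trans (ler_norm_sum _ _ _))//.
  apply: (@le_trans _ _ (series (exp_coeff C) n)).
    rewrite /series/= big_mkord; apply: ler_sum => k _.
    rewrite normrM normrX normfV [`|_%:R|]ger0_norm// ler_wpM2r ?invr_ge0//.
    by rewrite lerXn2r// ?nnegrE// (le_trans _ (fC z)).
  apply: nondecreasing_cvgn_le; last exact: is_cvg_series_exp_coeff.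
  apply: nondecreasing_series => k _ _; apply: exp_coeff_ge0.
  exact: le_trans (fC (point, point)).
have Sf z : S n z @[n --> \oo] --> (expR \o f) z by exact: is_cvg_series_exp_coeff.
have cE := signed_energy_bounded_cvg (fun n => (bS n).1) SC Sf.
rewrite -(cvg_lim _ cE)//; apply: limr_ge; first by apply/cvg_ex; eexists; exact: cE.
near=> n.
rewrite -signed_energy_tensor// -signed_energyZ; last exact: bounded_measurable_tensor.
have bchh : bounded_measurable (fun z : T * T => c * (h z.1 * h z.2)).
  by apply: bounded_measurableZ; exact: bounded_measurable_tensor.
rewrite -subr_ge0.
rewrite -mulN1r -signed_energyZ// -signed_energyD//; last exact: bounded_measurableZ.
apply: signed_energy_feature_kernel.
have n2 : (2 <= n)%N by near: n; exact: nbhs_infty_ge.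
rewrite (_ : (fun z => _) = fun z => (f z - c * (h z.1 * h z.2)) +
   (1 + \sum_(k <- iota 0 n.-2) k.+2`!%:R^-1 * f z ^+ k.+2)).
  apply: feature_kernelD => //; apply: feature_kernelD; first exact: feature_kernel_cst.
  apply: (@feature_kernel_sum _ _ (fun k z => k.+2`!%:R^-1 * f z ^+ k.+2)) => k.
  by apply: feature_kernelZ; [rewrite invr_ge0|exact: feature_kernelX].
apply/funext => z; rewrite SE.
have [p ->] : exists p, n = p.+2 by exists n.-2; rewrite -addn2 -subn2 subnK.
rewrite 2!big_ord_recl/= expr0 expr1 fact0 divr1 /bump/=.
have -> : iota 0 p = index_iota 0 p by rewrite /index_iota subn0.
rewrite big_mkord.
under eq_bigr do rewrite mulrC !add1n.
have -> : (1 + 0)`!%:R = 1 :> R by [].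
by rewrite divr1; ring.
Unshelve. all: by end_near. Qed.

End PositiveSemidefinite.

(** * Passage to the limit in the energy *)

(** Domination involves [K^\+] and not [K], so that it also makes sense where
    [K] is infinite. *)
Section KernelLimit.
Context d (T : measurableType d) (R : realType).
Variables (K : T -> \bar R) (S : (T -> R)^nat) (A B : R).
Hypothesis bS : forall n, bounded_measurable (S n).
Hypothesis SB : forall n z, - B <= S n z.
Hypothesis SA : forall n z, ((S n z)%:E <= A%:E * K^\+ z + B%:E)%E.
Hypothesis SK : forall z, (S n z)%:E @[n --> \oo] --> K z.
Hypothesis A0 : 0 <= A.
Hypothesis B0 : 0 <= B.

Lemma kernel_limit_measurable : measurable_fun setT K.
Proof.
apply: (emeasurable_fun_cvg (fun n => EFin \o S n)) => [n|z _]; last exact: SK.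
by apply/measurable_EFinP; case: (bS n).
Qed.

Let mK := kernel_limit_measurable.

Lemma kernel_limit_ge z : ((- B)%:E <= K z)%E.
Proof.
rewrite -(cvg_lim _ (@SK z))//; apply: lime_ge.
  by apply/cvg_ex; eexists; exact: SK.
by apply: nearW => n; rewrite lee_fin.
Qed.

Let KB_ge0 z : (0 <= K z + B%:E)%E.
Proof. by have := leeD2r B%:E (kernel_limit_ge z); rewrite -EFinD addNr. Qed.

Variable m : {measure set T -> \bar R}.
Hypothesis m_fin : (m setT < +oo)%E.

Let icst c : m.-integrable setT (EFin \o (fun=> c : R)).
Proof. exact/bounded_measurable_integrable/bounded_measurable_cst. Qed.

Local Open Scope ereal_scope.

Lemma integral_funeneg_kernel_limit : \int[m]_z K^\- z < +oo.
Proof.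
apply: (@le_lt_trans _ _ (\int[m]_z B%:E)).
  apply: ge0_le_integral => //; first exact: measurable_funeneg.
  move=> z _; rewrite funenegE ge_max lee_fin B0 andbT leeNl.
  exact: kernel_limit_ge.
by rewrite integral_cst// lte_mul_pinfty.
Qed.

Lemma integrable_kernel_limit :
  \int[m]_z K^\+ z < +oo -> m.-integrable setT K.
Proof.
move=> Kp; apply/integrableP; split => //.
rewrite (_ : (fun x => _) = fun z => K^\+ z + K^\- z); last first.
  by apply/funext => z; rewrite -/((abse \o K) z) fune_abse.
rewrite ge0_integralD//; last 2 first.
- exact: measurable_funepos.
- exact: measurable_funeneg.
by rewrite lte_add_pinfty// integral_funeneg_kernel_limit.
Qed.

Lemma Rintegral_kernel_limit_cvg : \int[m]_z K^\+ z < +oo ->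
  Rintegral m setT (S n) @[n --> \oo] --> fine (\int[m]_z K z).
Proof.
move=> Kp; have iK := integrable_kernel_limit Kp.
have iG : m.-integrable setT (fun z => A%:E * K^\+ z + B%:E).
  have iKp := integrable_funepos measurableT iK.
  exact: (integrableD measurableT (integrableZl measurableT A iKp) (icst B)).
have [] := @dominated_convergence _ _ _ m setT measurableT
  (fun n => EFin \o S n) K (fun z => A%:E * K^\+ z + B%:E).
- by move=> n; apply/measurable_EFinP; case: (bS n).
- by [].
- by apply: aeW => z _; exact: SK.
- exact: iG.
- apply: aeW => z n _ /=; have [S0|S0] := leP 0%R (S n z).
    by rewrite ger0_norm// SA.
  rewrite ltr0_norm// (@le_trans _ _ B%:E)//; first by rewrite lee_fin lerNl.
  by rewrite leeDr// mule_ge0.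
move=> _ _ h; apply: fine_cvg; rewrite fineK; first exact: h.
exact: integrable_fin_num.
Qed.

(** Fatou's lemma for the nonnegative functions S n + B. *)
Lemma integral_funepos_kernel_limit (M : R) :
  (forall n, (Rintegral m setT (S n) <= M)%R) -> \int[m]_z K^\+ z < +oo.
Proof.
move=> SM.
have iS n := bounded_measurable_integrable m_fin (bS n).
pose f n z := (S n z + B)%:E.
have f0 n z : setT z -> 0 <= f n z by rewrite lee_fin -lerBlDr sub0r SB.
have mf n : measurable_fun setT (f n).
  apply/measurable_EFinP; apply: measurable_funD => //; by case: (bS n).
have := fatou m measurableT mf f0.
have -> : \int[m]_z limn_einf (f^~ z) = \int[m]_z (K z + B%:E).
  apply: eq_integral => z _.
  have c : (S n z)%:E + B%:E @[n --> \oo] --> K z + B%:E.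
    by apply: cvgeD; [exact: fin_num_adde_defl|exact: SK|exact: cvg_cst].
  rewrite is_cvg_limn_einfE; first exact: cvg_lim.
  by apply/cvg_ex; eexists; exact: c.
move=> h.
apply: (@le_lt_trans _ _ (\int[m]_z (K z + B%:E))).
  apply: ge0_le_integral => //.
  - exact: measurable_funepos.
  - exact: emeasurable_funD.
  - by move=> z _; rewrite funeposE ge_max leeDl ?lee_fin//=.
apply: (le_lt_trans h).
have fM n : \int[m]_z f n z <= (M + B * fine (m setT))%:E.
  have -> : \int[m]_z f n z = (Rintegral m setT (fun z => S n z + B)%R)%:E.
    rewrite /Rintegral fineK//; apply: integrable_fin_num => //.
    exact: (bounded_measurable_integrable m_fin
      (bounded_measurableD (bS n) (bounded_measurable_cst T B))).
  rewrite lee_fin RintegralD// Rintegral_cst//.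
  by rewrite lerD2r SM.
apply: (@le_lt_trans _ _ (M + B * fine (m setT))%:E); last exact: ltry.
rewrite limn_einf_lim; apply: lime_le; first exact: is_cvg_einfs.
apply: nearW => n; apply: le_trans (fM n); apply: ereal_inf_lbound.
by exists n => /=.
Qed.

End KernelLimit.

Section EnergyLimit.
Context d (T : measurableType d) (R : realType).
Variables (K : T * T -> \bar R) (S : (T * T -> R)^nat) (A B : R).
Hypothesis bS : forall n, bounded_measurable (S n).
Hypothesis SB : forall n z, - B <= S n z.
Hypothesis SA : forall n z, ((S n z)%:E <= A%:E * K^\+ z + B%:E)%E.
Hypothesis SK : forall z, (S n z)%:E @[n --> \oo] --> K z.
Hypothesis A0 : 0 <= A.
Hypothesis B0 : 0 <= B.
Variables mu nu : {finite_measure set T -> \bar R}.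
Hypothesis SE : forall n, 0 <= signed_energy mu nu (S n).

Local Open Scope ereal_scope.

Let Epos := \int[mu \x mu]_z K^\+ z + \int[nu \x nu]_z K^\+ z
  + \int[mu \x nu]_z K^\- z + \int[nu \x mu]_z K^\- z.
Let Eneg := \int[mu \x nu]_z K^\+ z + \int[nu \x mu]_z K^\+ z
  + \int[mu \x mu]_z K^\- z + \int[nu \x nu]_z K^\- z.

(** A finite positive part gives the convergence of the two diagonal
    integrals of S n by domination. As the energy of S n is nonnegative, the sum
    of its two mixed integrals is then bounded above; each of them is bounded
    below, hence bounded above, and Fatou's lemma shows that the mixed integrals
    of K are finite too. Domination now applies to all four integrals. *)
Lemma signed_energy_limit : Epos < +oo ->
  [/\ Epos \is a fin_num, Eneg \is a fin_num &
    signed_energy mu nu (S n) @[n --> \oo] --> (fine Epos - fine Eneg)%R].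
Proof.
move=> Eoo.
have Ip (m : {measure set (T * T) -> \bar R}) : 0 <= \int[m]_z K^\+ z by exact: integral_ge0.
have In (m : {measure set (T * T) -> \bar R}) : 0 <= \int[m]_z K^\- z by exact: integral_ge0.
have le1 (a b c e : \bar R) : 0 <= b -> 0 <= c -> 0 <= e -> a <= a + b + c + e.
  by move=> b0 c0 e0; rewrite -!addeA leeDl// !adde_ge0.
have [pm pn] : \int[mu \x mu]_z K^\+ z < +oo /\ \int[nu \x nu]_z K^\+ z < +oo.
  split; apply: le_lt_trans Eoo; rewrite /Epos; first exact: le1 (Ip _) (In _) (In _).
  by rewrite [X in X + _ + _]addeC; exact: le1 (Ip _) (In _) (In _).
have fin (m1 m2 : {finite_measure set T -> \bar R}) : (m1 \x m2) setT < +oo.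
  exact: product_finite.
have cm := Rintegral_kernel_limit_cvg bS SB SA SK A0 B0 (fin _ _) pm.
have cn := Rintegral_kernel_limit_cvg bS SB SA SK A0 B0 (fin _ _) pn.
have [M SM] : exists M : R, forall n,
    (Rintegral (mu \x mu) setT (S n) + Rintegral (nu \x nu) setT (S n) <= M)%R.
  have [M [_ hM]] := cvg_seq_bounded (cvgP _ (cvgD cm cn)).
  exists (M + 1)%R => n; apply: le_trans (ler_norm _) _.
  by apply: hM => //; rewrite ltrDl.
have lb (m1 m2 : {finite_measure set T -> \bar R}) n :
    (- B * fine ((m1 \x m2) setT) <= Rintegral (m1 \x m2) setT (S n))%R.
  rewrite -Rintegral_cst//; apply: le_Rintegral => //.
    exact: (bounded_measurable_integrable (fin m1 m2) (bounded_measurable_cst _ _)).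
  exact: (bounded_measurable_integrable (fin m1 m2) (bS n)).
have cM n : (Rintegral (mu \x nu) setT (S n) + Rintegral (nu \x mu) setT (S n) <= M)%R.
  by apply: le_trans (SM n); rewrite -subr_ge0; exact: SE.
have p1 : \int[mu \x nu]_z K^\+ z < +oo.
  apply: (integral_funepos_kernel_limit bS SB SK B0 (fin _ _)
    (M := (M + B * fine ((nu \x mu) setT))%R)) => n.
  by rewrite -lerBlDr (le_trans _ (cM n))// lerD2l -mulNr; exact: lb.
have p2 : \int[nu \x mu]_z K^\+ z < +oo.
  apply: (integral_funepos_kernel_limit bS SB SK B0 (fin _ _)
    (M := (M + B * fine ((mu \x nu) setT))%R)) => n.
  by rewrite -lerBlDr (le_trans _ (cM n))// addrC lerD2r -mulNr; exact: lb.
have c1 := Rintegral_kernel_limit_cvg bS SB SA SK A0 B0 (fin _ _) p1.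
have c2 := Rintegral_kernel_limit_cvg bS SB SA SK A0 B0 (fin _ _) p2.
have nf (m1 m2 : {finite_measure set T -> \bar R}) :
    \int[m1 \x m2]_z K^\- z \is a fin_num.
  rewrite ge0_fin_numE; last exact: (In (m1 \x m2)).
  exact: (integral_funeneg_kernel_limit bS SB SK B0 (fin m1 m2)).
have pf (m1 m2 : {finite_measure set T -> \bar R}) :
    \int[m1 \x m2]_z K^\+ z < +oo -> \int[m1 \x m2]_z K^\+ z \is a fin_num.
  by rewrite ge0_fin_numE; last exact: (Ip (m1 \x m2)).
have fE (m1 m2 : {finite_measure set T -> \bar R}) : \int[m1 \x m2]_z K^\+ z < +oo ->
    fine (\int[m1 \x m2]_z K z) =
    (fine (\int[m1 \x m2]_z K^\+ z) - fine (\int[m1 \x m2]_z K^\- z))%R.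
  by move=> /pf p; rewrite integralE fineB; [|exact: p|exact: nf].
move: (pf _ _ pm) (pf _ _ pn) (pf _ _ p1) (pf _ _ p2) => fm fn f1 f2.
have fD (a b c e : \bar R) : a \is a fin_num -> b \is a fin_num ->
    c \is a fin_num -> e \is a fin_num -> a + b + c + e \is a fin_num.
  by move: a b c e => [a||] [b||] [c||] [e||].
have fineD4 (a b c e : \bar R) : a \is a fin_num -> b \is a fin_num ->
    c \is a fin_num -> e \is a fin_num ->
    fine (a + b + c + e) = (fine a + fine b + fine c + fine e)%R.
  by move: a b c e => [a||] [b||] [c||] [e||].
split; [by apply: fD|by apply: fD|].
rewrite /Epos /Eneg !fineD4//.
rewrite [X in _ --> X](_ : _ =
  (fine (\int[mu \x mu]_z K z) + fine (\int[nu \x nu]_z K z) -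
   (fine (\int[mu \x nu]_z K z) + fine (\int[nu \x mu]_z K z)))%R).
  exact: cvgB (cvgD cm cn) (cvgD c1 c2).
rewrite !fE//; ring.
Qed.

End EnergyLimit.

(** * Measures determined by their moments *)

Section Smoothstep.
Variable R : realType.
Implicit Types x : R.

(** This polynomial fixes 0, 1/2 and 1 and pushes the other points of [0, 1]
    away from 1/2, so its iterates converge to a step function. *)
Definition smoothstep x : R := 3 * x ^+ 2 - 2 * x ^+ 3.

Lemma smoothstepC x : smoothstep (1 - x) = 1 - smoothstep x.
Proof. rewrite /smoothstep; ring. Qed.

Lemma smoothstep_itv x : 0 <= x <= 1 -> 0 <= smoothstep x <= 1.
Proof.
move=> /andP[x0 x1]; rewrite /smoothstep; apply/andP; split.
  rewrite (_ : _ - _ = x ^+ 2 * (3 - 2 * x)); last ring.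
  by rewrite mulr_ge0 ?sqr_ge0//; lra.
rewrite -subr_ge0 (_ : _ - _ = (1 - x) ^+ 2 * (1 + 2 * x)); last ring.
by rewrite mulr_ge0 ?sqr_ge0//; lra.
Qed.

Lemma iter_smoothstep_itv n x : 0 <= x <= 1 -> 0 <= iter n smoothstep x <= 1.
Proof. by move=> x01; elim: n => //= n; exact: smoothstep_itv. Qed.

(** Since smoothstep y = y (3 - 2 y) y and y (3 - 2 y) increases on [0, 1/2],
    staying below 1 before 1/2, the iterates decrease geometrically. *)
Lemma iter_smoothstep_cvg0 x : 0 <= x < 2^-1 ->
  iter n smoothstep x @[n --> \oo] --> 0.
Proof.
move=> /andP[x0 x2]; pose r := x * (3 - 2 * x).
have r0 : 0 <= r by rewrite /r; nra.
have r1 : r < 1 by rewrite /r; nra.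
have bnd n : 0 <= iter n smoothstep x <= r ^+ n * x /\ iter n smoothstep x <= x.
  elim: n => [|n [/andP[h0 h1] h2]]; first by rewrite expr0 mul1r/= x0 !lexx.
  set y := iter n smoothstep x in h0 h1 h2 *; rewrite iterS -/y.
  have e : smoothstep y = y * (3 - 2 * y) * y by rewrite /smoothstep; ring.
  have yr : y * (3 - 2 * y) <= r by rewrite /r; nra.
  have y1 : 0 <= y * (3 - 2 * y) by nra.
  have er : smoothstep y <= r * y by rewrite e ler_wpM2r.
  split; last nra.
  by rewrite e mulr_ge0//= -e (le_trans er)// exprS -mulrA ler_wpM2l.
apply: (@squeeze_cvgr _ _ _ _ (fun=> 0) (fun n => r ^+ n * x)).
- by apply: nearW => n; case: (bnd n).
- exact: cvg_cst.
- rewrite -(mul0r x); apply: cvgMl; apply: cvg_expr.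
  by rewrite ger0_norm.
Qed.

Lemma iter_smoothstep_cvg1 x : 2^-1 < x <= 1 ->
  iter n smoothstep x @[n --> \oo] --> (1 : R).
Proof.
move=> x2; have c : 0 <= 1 - x < 2^-1 by lra.
have e n : iter n smoothstep x = 1 - iter n smoothstep (1 - x).
  by elim: n => [|n IH] /=; [ring|rewrite IH smoothstepC].
under eq_fun do rewrite e.
suff : 1 - iter n smoothstep (1 - x) @[n --> \oo] --> (1 - 0 : R).
  by rewrite subr0.
apply: cvgB; first exact: cvg_cst.
exact: iter_smoothstep_cvg0.
Qed.

Lemma iter_smoothstep_half n : iter n smoothstep (2^-1 : R) = 2^-1.
Proof. by elim: n => //= n ->; rewrite /smoothstep; lra. Qed.

End Smoothstep.

Section MomentProblem.
Context d (T : measurableType d) (R : realType).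
Variables mu nu : {finite_measure set T -> \bar R}.
Variables (I : Type) (phi : I -> T -> R).
Hypothesis mphi : forall i, measurable_fun setT (phi i).
Hypothesis phi1 : forall i x, `|phi i x| <= 1.

Definition monomial (w : seq I) x : R := \prod_(i <- w) phi i x.

Local Lemma bounded_measurable_coordinate i : bounded_measurable (phi i).
Proof. by split; [exact: mphi|exists 1]. Qed.

Lemma bounded_measurable_monomial w : bounded_measurable (monomial w).
Proof.
elim: w => [|i w IH]; rewrite /monomial.
  by under eq_fun do rewrite big_nil; exact: bounded_measurable_cst.
under eq_fun do rewrite big_cons.
exact: bounded_measurableM (bounded_measurable_coordinate i) IH.
Qed.

(** The signed measure g (mu - nu) annihilates all polynomials. *)
Definition moment_free (g : T -> R) := bounded_measurable g /\
  forall w, signed_integral mu nu (fun x => monomial w x * g x) = 0.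

(** Asking f to preserve all functions orthogonal to the polynomials, rather
    than to be a limit of polynomials, makes stability under products and under
    iterated limits immediate. *)
Definition moment_multiplier (f : T -> R) := bounded_measurable f /\
  forall g, moment_free g -> moment_free (fun x => f x * g x).

Let fin (m : {finite_measure set T -> \bar R}) : (m setT < +oo)%E.
Proof. by rewrite ltey_eq fin_num_measure. Qed.

Local Notation sint := (signed_integral mu nu).

Lemma signed_integralD f g : bounded_measurable f -> bounded_measurable g ->
  sint (fun x => f x + g x) = sint f + sint g.
Proof.
move=> bf bg; rewrite /signed_integral !RintegralD//; first ring;
  exact: (bounded_measurable_integrable (fin _)).
Qed.

Lemma signed_integralZ c f : bounded_measurable f ->
  sint (fun x => c * f x) = c * sint f.
Proof.
move=> bf; rewrite /signed_integral !RintegralZl//; first ring;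
  exact: (bounded_measurable_integrable (fin _)).
Qed.

Lemma moment_multiplier_coordinate i : moment_multiplier (phi i).
Proof.
split=> [|g [bg g0]]; first exact: bounded_measurable_coordinate.
split; first exact: bounded_measurableM (bounded_measurable_coordinate i) bg.
move=> w; rewrite -(g0 (i :: w)); congr signed_integral; apply/funext => x.
by rewrite /monomial big_cons mulrCA mulrA.
Qed.

Lemma moment_multiplierD f f' : moment_multiplier f -> moment_multiplier f' ->
  moment_multiplier (fun x => f x + f' x).
Proof.
move=> [bf fm] [bf' fm']; split; first exact: bounded_measurableD.
move=> g g0; have [b e] := fm _ g0; have [b' e'] := fm' _ g0; split.
  by under eq_fun do rewrite mulrDl; exact: bounded_measurableD.
move=> w; under eq_fun do rewrite mulrDl mulrDr.
by rewrite signed_integralD ?e ?e' ?addr0//;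
  apply: bounded_measurableM => //; exact: bounded_measurable_monomial.
Qed.

Lemma moment_multiplierM f f' : moment_multiplier f -> moment_multiplier f' ->
  moment_multiplier (fun x => f x * f' x).
Proof.
move=> [bf fm] [bf' fm']; split; first exact: bounded_measurableM.
by move=> g /fm' /fm; under eq_fun do rewrite mulrA.
Qed.

Lemma moment_multiplier_cst c : moment_multiplier (fun=> c).
Proof.
split=> [|g [bg g0]]; first exact: bounded_measurable_cst.
split=> [|w]; first exact: bounded_measurableZ.
under eq_fun do rewrite mulrCA.
rewrite signed_integralZ ?g0 ?mulr0//.
by apply: bounded_measurableM => //; exact: bounded_measurable_monomial.
Qed.

Lemma moment_multiplierZ c f : moment_multiplier f ->
  moment_multiplier (fun x => c * f x).
Proof. exact/moment_multiplierM/moment_multiplier_cst. Qed.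

Lemma moment_multiplierX n f : moment_multiplier f ->
  moment_multiplier (fun x => f x ^+ n).
Proof.
move=> mf; elim: n => [|n IH].
  by under eq_fun do rewrite expr0; exact: moment_multiplier_cst.
by under eq_fun do rewrite exprS; exact: moment_multiplierM.
Qed.

Lemma moment_multiplier_lim (f_ : (T -> R)^nat) f C :
  (forall n, moment_multiplier (f_ n)) -> (forall n x, `|f_ n x| <= C) ->
  (forall x, f_ n x @[n --> \oo] --> f x) -> moment_multiplier f.
Proof.
move=> mf fC ff; have bf := bounded_measurable_lim (fun n => (mf n).1.1) fC ff.
split=> // g g0; have [[mg [D gD]] _] := g0.
split; first by apply: bounded_measurableM => //; exact: g0.1.
move=> w; have [mw [E wE]] := bounded_measurable_monomial w.
pose h n x := monomial w x * (f_ n x * g x).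
have hC n x : `|h n x| <= E * (C * D) by rewrite !normrM !ler_pM// mulr_ge0.
have mh n : measurable_fun setT (h n).
  apply: measurable_funM => //; apply: measurable_funM => //; exact: (mf n).1.1.
have hl x : h n x @[n --> \oo] --> monomial w x * (f x * g x).
  by apply: cvgMr; apply: cvgMl; exact: ff.
have cL : Rintegral mu setT (h n) - Rintegral nu setT (h n) @[n --> \oo] -->
    sint (fun x => monomial w x * (f x * g x)).
  by apply: cvgB; exact: (Rintegral_bounded_cvg (fin _) mh hC hl).
have e n : Rintegral mu setT (h n) - Rintegral nu setT (h n) = 0.
  by have [_ /(_ w)] := (mf n).2 _ g0.
rewrite -(cvg_lim _ cL)//; under eq_fun do rewrite e.
exact: lim_cst.
Qed.

(** An affine function q of phi i takes values in [0, 1] and exceeds 1/2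
    exactly where phi i > b. The iterates of [smoothstep] at q converge to the
    indicator of q > 1/2, except that the limit is 1/2 where q = 1/2; the
    indicator of that level set is the limit of the powers of
    1 - 4 (q - 1/2) ^ 2, and half of it is subtracted. *)
Lemma moment_multiplier_superlevel i b :
  moment_multiplier (\1_[set x | b < phi i x]).
Proof.
(* Since |phi i x - b| <= 1 + |b|, the product by c is at most 1/2 in norm. *)
pose c := (2 * (1 + `|b|))^-1.
have c0 : 0 < c by rewrite invr_gt0 mulr_gt0// ltr_pwDl.
pose q x := 2^-1 + c * (phi i x + - b).
have mq : moment_multiplier q.
  apply: moment_multiplierD; first exact: moment_multiplier_cst.
  apply: moment_multiplierZ; apply: moment_multiplierD.
    exact: moment_multiplier_coordinate.
  exact: moment_multiplier_cst.
have q01 x : 0 <= q x <= 1.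
  have : `|c * (phi i x - b)| <= 2^-1.
    have b0 : 0 < 1 + `|b| by rewrite ltr_pwDl.
    have pb : `|phi i x - b| <= 1 + `|b|.
      by rewrite (le_trans (ler_normB _ _))// lerD2r phi1.
    by rewrite normrM gtr0_norm// /c invfM -mulrA ler_piMr// ler_pdivrMl// mulr1.
  rewrite ler_norml /q; lra.
have mS n : moment_multiplier (fun x => iter n (@smoothstep R) (q x)).
  elim: n => [//|n IH] /=; rewrite /smoothstep.
  apply: moment_multiplierD; first exact/moment_multiplierZ/moment_multiplierX.
  under eq_fun do rewrite -mulNr.
  exact/moment_multiplierZ/moment_multiplierX.
pose l1 x := if q x < 2^-1 then 0 else if q x == 2^-1 then 2^-1 else 1 : R.
have m1 : moment_multiplier l1.
  apply: (moment_multiplier_lim mS (C := 1)) => [n x|x].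
    have /andP[h0 h1] := iter_smoothstep_itv n (q01 x).
    by rewrite ger0_norm.
  have /andP[h0 h1] := q01 x; rewrite /l1; case: ltgtP => [h|h|->].
  - by apply: iter_smoothstep_cvg0; rewrite h0.
  - by apply: iter_smoothstep_cvg1; rewrite h.
  - by under eq_fun do rewrite iter_smoothstep_half; exact: cvg_cst.
pose p x := 1 + (-4) * (q x + - 2^-1) ^+ 2.
have mp : moment_multiplier p.
  apply: moment_multiplierD; first exact: moment_multiplier_cst.
  apply/moment_multiplierZ/moment_multiplierX/moment_multiplierD => //.
  exact: moment_multiplier_cst.
have p01 x : 0 <= p x <= 1.
  have /andP[q0 q1] := q01 x; have := sqr_ge0 (q x - 2^-1).
  have : 0 <= q x * (1 - q x) by rewrite mulr_ge0 ?subr_ge0.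
  rewrite /p => ? ?; apply/andP; split; lra.
pose l2 x := (q x == 2^-1)%:R : R.
have m2 : moment_multiplier l2.
  apply: (moment_multiplier_lim (fun n => moment_multiplierX n mp) (C := 1)) => [n x|x].
    have /andP[h0 h1] := p01 x.
    by rewrite ger0_norm ?exprn_ge0// exprn_ile1.
  rewrite /l2; case: eqP => [e|/eqP ne].
    rewrite /p e subrr expr0n mulr0 addr0.
    by under eq_fun do rewrite expr1n; exact: cvg_cst.
  apply: cvg_expr; have /andP[h0 h1] := p01 x; rewrite ger0_norm// /p.
  have : 0 < (q x - 2^-1) ^+ 2 by rewrite exprn_even_gt0//= subr_eq0.
  lra.
have := moment_multiplierD m1 (moment_multiplierZ (- 2^-1) m2).
congr moment_multiplier; apply/funext => x.
rewrite /l1 /l2 indicE.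
have -> : (x \in [set x | b < phi i x]) = (2^-1 < q x).
  by apply/idP/idP; rewrite inE/= /q ltrDl pmulr_rgt0// subr_gt0.
by case: ltgtP => // h; rewrite ?mulr0 ?mulr1 ?addr0 ?subrr.
Qed.

(** Finite intersections are products of indicators; the indicator of the
    complement of a countable union is the limit of the products of the
    indicators of the complements. *)
Lemma moment_multiplier_sigma_algebra :
  sigma_algebra setT [set A | moment_multiplier (\1_A)].
Proof.
have mC A : moment_multiplier \1_A -> moment_multiplier (\1_(~` A)).
  move=> mA; have := moment_multiplierD (moment_multiplier_cst 1)
    (moment_multiplierZ (-1) mA).
  congr moment_multiplier; apply/funext => x.
  by rewrite !indicE in_setC; case: (_ \in A) => /=; rewrite ?mulr1 ?subrr ?mulr0 ?addr0.
split => [/=|A /= mA|F /= mF].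
- by rewrite indic0; exact: moment_multiplier_cst.
- by rewrite setTD; exact: mC.
rewrite -[\bigcup_k F k]setCK; apply: (mC).
apply: (@moment_multiplier_lim (fun n x => \prod_(k < n) \1_(~` F k) x) _ 1).
- elim=> [|n IH].
    by under eq_fun do rewrite big_ord0; exact: moment_multiplier_cst.
  under eq_fun do rewrite big_ord_recr; apply: moment_multiplierM => //.
  exact: mC (mF _).
- move=> n x; rewrite ger0_norm ?prodr_ge0// prodr_ile1// => k _.
  by rewrite indicE; case: (_ \in _) => /=; rewrite lexx ler01.
move=> x; rewrite indicE in_setC.
have [[k _ xk]|nx] := pselect ((\bigcup_k F k) x).
  rewrite mem_set/=; last by exists k.
  apply: cvg_near_cst; near=> n.
  have kn : (k < n)%N by near: n; exact: nbhs_infty_gt.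
  by rewrite (bigD1 (Ordinal kn))//= indicE in_setC mem_set//= mul0r.
rewrite memNset//=; apply: cvg_near_cst; near=> n; rewrite big1// => k _.
by rewrite indicE in_setC memNset// => xk; apply: nx; exists k.
Unshelve. all: by end_near. Qed.

(** The constant 1 is orthogonal to all polynomials by the hypothesis on the
    moments, so the indicator of each measurable set, being a multiplier, is
    orthogonal to the constant 1. *)
Lemma moments_determine_measure :
  (forall w, signed_integral mu nu (monomial w) = 0) ->
  (forall G, sigma_algebra setT G ->
    (forall i b, G [set x | b < phi i x]) -> measurable `<=` G) ->
  forall A, measurable A -> mu A = nu A.
Proof.
move=> w0 gen A mA.
have mf1 : moment_free (fun=> 1).
  split=> [|w]; first exact: bounded_measurable_cst.
  by under eq_fun do rewrite mulr1; exact: w0.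
have [_ mm] := gen _ moment_multiplier_sigma_algebra moment_multiplier_superlevel A mA.
have [_ /(_ [::])] := mm _ mf1.
rewrite /signed_integral /monomial.
under eq_fun do rewrite big_nil mulr1 mul1r.
rewrite /Rintegral !integral_indic// !setIT => /eqP.
rewrite subr_eq0 => /eqP e.
by rewrite -[LHS]fineK ?fin_num_measure// -[RHS]fineK ?fin_num_measure// e.
Qed.

End MomentProblem.

(** * Riesz kernels on a subset of a sphere *)

(** The coordinates [phi] embed T in the unit sphere of a Euclidean space. The
    affine hyperplane containing the image serves twice: it excludes antipodal
    points, at which the logarithmic series is beyond the reach of a geometric
    estimate, and it expresses the constant 1 by the coordinates. *)
Section RieszKernelOnSphere.
Context d (T : measurableType d) (R : realType).
Variables (I : finType) (phi : I -> T -> R).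
Hypothesis mphi : forall i, measurable_fun setT (phi i).
Hypothesis phi_sphere : forall x, \sum_i phi i x ^+ 2 = 1.
Hypothesis phi_inj : forall x y, (forall i, phi i x = phi i y) -> x = y.
Variable a : I -> R.
Hypothesis phi_hyperplane : forall x, \sum_i a i * phi i x = 1.
Hypothesis phi_generates : forall G : set (set T), sigma_algebra setT G ->
  (forall i b, G [set x | b < phi i x]) -> measurable `<=` G.

Definition gram (z : T * T) : R := \sum_i phi i z.1 * phi i z.2.

Local Lemma coordinate_le1 i x : `|phi i x| <= 1.
Proof.
have : `|phi i x| ^+ 2 <= 1 ^+ 2.
  rewrite -normrX ger0_norm ?sqr_ge0// expr1n -(phi_sphere x) (bigD1 i)//=.
  by rewrite lerDl sumr_ge0// => j _; exact: sqr_ge0.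
by rewrite ler_pXn2r// ?nnegrE.
Qed.

(** Used with e = 1 and e = -1, for the distance of z.1 to z.2 and to the
    antipode of z.2. *)
Local Lemma gram_sumsq (e : R) z : e ^+ 2 = 1 ->
  \sum_i (phi i z.1 - e * phi i z.2) ^+ 2 = 2 - 2 * (e * gram z).
Proof.
move=> e2; rewrite (eq_bigr (fun i => phi i z.1 ^+ 2 + phi i z.2 ^+ 2 -
  2 * e * (phi i z.1 * phi i z.2))).
  by rewrite sumrB big_split/= !phi_sphere -mulr_sumr -/(gram z) mulrA.
move=> i _; rewrite sqrrB exprMn e2; ring.
Qed.

Local Lemma gram_gtN1 z : -1 < gram z.
Proof.
have := gram_sumsq z (sqrr_sign R 1); rewrite expr1.
have s0 : 0 <= \sum_i (phi i z.1 - -1 * phi i z.2) ^+ 2.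
  by apply: sumr_ge0 => i _; exact: sqr_ge0.
rewrite lt_neqAle => e; apply/andP; split; last lra.
apply/eqP => g; have {}s0 : \sum_i (phi i z.1 - -1 * phi i z.2) ^+ 2 = 0 by lra.
have /eqP := phi_hyperplane z.1.
rewrite (eq_bigr (fun i => - (a i * phi i z.2))) ?sumrN ?phi_hyperplane.
  by lra.
move=> i _; have /eqP : (phi i z.1 - -1 * phi i z.2) ^+ 2 = 0.
  by apply: (psumr_eq0P _ s0) => // j _; exact: sqr_ge0.
rewrite sqrf_eq0 mulN1r opprK addr_eq0 => /eqP ->; ring.
Qed.

Local Lemma gram_lt1 z : z.1 != z.2 -> gram z < 1.
Proof.
move=> z12; have := gram_sumsq z (expr1n R 2).
have s0 : 0 <= \sum_i (phi i z.1 - 1 * phi i z.2) ^+ 2.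
  by apply: sumr_ge0 => i _; exact: sqr_ge0.
rewrite lt_neqAle => e; apply/andP; split; last lra.
apply: contra z12 => /eqP g; apply/eqP/phi_inj => i.
have {}s0 : \sum_i (phi i z.1 - 1 * phi i z.2) ^+ 2 = 0 by lra.
have /eqP : (phi i z.1 - 1 * phi i z.2) ^+ 2 = 0.
  by apply: (psumr_eq0P _ s0) => // j _; exact: sqr_ge0.
by rewrite sqrf_eq0 mul1r subr_eq0 => /eqP.
Qed.

Local Lemma gram_diag x : gram (x, x) = 1.
Proof. by rewrite -(phi_sphere x); apply: eq_bigr => i _; rewrite expr2. Qed.

Local Notation mono := (monomial phi).

Local Lemma coordinate_bounded i : bounded_measurable (phi i).
Proof. by split; [exact: mphi|exists 1; exact: coordinate_le1]. Qed.

Lemma feature_kernel_gram : feature_kernel gram.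
Proof.
apply: (@feature_kernel_sum _ _ _ _ _ (fun i z => phi i z.1 * phi i z.2)) => i.
exact: feature_kernel_tensor (coordinate_bounded i).
Qed.

(** Expanding the power of the inner product gives the sum of m(x) m(y) over
    all words m of length [size w]; removing one of them leaves a sum of the
    same kind. *)
Lemma feature_kernel_gramX_sub_monomial w :
  feature_kernel (fun z => gram z ^+ size w - mono w z.1 * mono w z.2).
Proof.
elim: w => [|i w IH].
  rewrite (_ : (fun z => _) = fun=> 0); first exact: feature_kernel0.
  by apply/funext => z; rewrite /monomial !big_nil expr0 mulr1 subrr.
have kgi : feature_kernel (fun z => gram z - phi i z.1 * phi i z.2).
  rewrite (_ : (fun z => _) =
     fun z => \sum_(j <- enum I | j != i) phi j z.1 * phi j z.2).
    under eq_fun do rewrite -big_filter.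
    apply: (@feature_kernel_sum _ _ _ _ _ (fun i z => phi i z.1 * phi i z.2)) => j.
    exact: feature_kernel_tensor (coordinate_bounded j).
  by apply/funext => z; rewrite /gram (bigD1 i)//= addrAC subrr add0r big_enum_cond.
have := feature_kernelD (feature_kernelM feature_kernel_gram IH)
  (feature_kernelM kgi (feature_kernel_tensor
    (bounded_measurable_monomial mphi coordinate_le1 w))).
congr feature_kernel; apply/funext => z.
rewrite /monomial !big_cons -!/(monomial _ _ _) /= exprS; ring.
Qed.

Variable s : R.
Hypothesis s0 : 0 <= s.

Definition sphere_kernel (x y : T) : \bar R :=
  if x == y then +oo%E
  else if s == 0 then (- ln (Num.sqrt (1 - gram (x, y))))%:E
  else (Num.sqrt (1 - gram (x, y)) `^ (- s))%:E.

Let K z := sphere_kernel z.1 z.2.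

Let L n z := half_log_series n (gram z).

(** Only the logarithm is truncated: monotonicity and continuity of the
    exponential then transfer the bounds and the limit of its partial sums. *)
Definition truncated_kernel n z : R := if s == 0 then L n z else expR (s * L n z).

Local Notation S := truncated_kernel.

Local Lemma feature_kernel_half_log n : feature_kernel (L n).
Proof.
apply: (@feature_kernel_sum _ _ _ _ _
  (fun k : 'I_n => fun z => k.+1%:R^-1 / 2 * gram z ^+ k.+1)) => k.
apply: feature_kernelZ; first by rewrite mulr_ge0// invr_ge0.
exact: feature_kernelX feature_kernel_gram.
Qed.

Local Lemma feature_kernel_half_log_sub n i w : (size w < n)%N ->
  feature_kernel (fun z => L n z - (size w).+1%:R^-1 / 2 *
    (mono (i :: w) z.1 * mono (i :: w) z.2)).
Proof.
move=> wn; pose k0 := Ordinal wn.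
pose c (k : 'I_n) : R := k.+1%:R^-1 / 2.
have c0 k : 0 <= c k by rewrite mulr_ge0// invr_ge0.
rewrite (_ : (fun z => _) = fun z =>
  c k0 * (gram z ^+ size (i :: w) - mono (i :: w) z.1 * mono (i :: w) z.2)
  + \sum_(k <- enum 'I_n | k != k0) c k * gram z ^+ k.+1).
  apply: feature_kernelD.
    exact: feature_kernelZ (c0 _) (feature_kernel_gramX_sub_monomial _).
  under eq_fun do rewrite -big_filter.
  apply: (@feature_kernel_sum _ _ _ _ _ (fun k z => c k * gram z ^+ k.+1)) => k.
  exact: feature_kernelZ (c0 _) (feature_kernelX _ feature_kernel_gram).
apply/funext => z; rewrite /L /half_log_series (bigD1 k0)//= big_enum_cond/=.
rewrite mulrBr -!addrA; congr (_ + _); rewrite addrC; congr (_ + _).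
Qed.

Local Lemma truncated_kernel_bounded n : bounded_measurable (S n).
Proof.
have kL := feature_kernel_half_log n.
have [mL [C LC]] := feature_kernel_bounded_measurable kL.
rewrite /truncated_kernel; case: (s == 0); first by split => //; exists C.
split; first by apply: measurableT_comp => //; exact: measurable_funM.
exists (expR (s * C)) => z; rewrite ger0_norm ?expR_ge0// ler_expR.
by rewrite ler_wpM2l// (le_trans (ler_norm _)).
Qed.

Local Lemma gram_norm_lt1 z : z.1 != z.2 -> `|gram z| < 1.
Proof. by move=> z12; rewrite ltr_norml gram_gtN1 gram_lt1. Qed.

Local Lemma gram_eq1 z : z.1 = z.2 -> gram z = 1.
Proof. by case: z => x y /= ->; exact: gram_diag. Qed.

Local Lemma truncated_kernel_geN1 n z : -1 <= S n z.
Proof.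
rewrite /truncated_kernel; case: ifPn => _; last first.
  by rewrite (le_trans _ (expR_ge0 _))// oppr_le0.
have [/gram_eq1 g1|z12] := eqVneq z.1 z.2; last first.
  by have /andP[] := half_log_series_bounds n (gram_norm_lt1 z12).
rewrite /L g1 (@le_trans _ _ 0) ?oppr_le0//.
by apply: sumr_ge0 => k _; rewrite expr1n mulr1 mulr_ge0 ?invr_ge0.
Qed.

Local Lemma sphere_kernelE z : z.1 != z.2 ->
  K z = (if s == 0 then half_log (gram z) else expR (s * half_log (gram z)))%:E.
Proof.
move=> z12; have g1 := gram_lt1 z12.
rewrite /K /sphere_kernel (negbTE z12) -(surjective_pairing z).
case: ifPn => // s0'; congr EFin.
have p : 0 < Num.sqrt (1 - gram z) by rewrite sqrtr_gt0 subr_gt0.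
by rewrite /powR gt_eqF// /half_log mulNr mulrN.
Qed.

Local Lemma sphere_kernel_diag z : z.1 = z.2 -> K z = +oo%E.
Proof. by rewrite /K /sphere_kernel => ->; rewrite eqxx. Qed.

(** From [L n <= half_log + 1]: the shift by 1 becomes the factor [expR s]
    after exponentiation, and the additive constant when s = 0. *)
Local Lemma truncated_kernel_le n z :
  ((S n z)%:E <= (expR s)%:E * K^\+ z + 1%:E)%E.
Proof.
rewrite funeposE; have [z12|z12] := eqVneq z.1 z.2.
  by rewrite sphere_kernel_diag// maxye gt0_muley ?lte_fin ?expR_gt0// addye// leey.
have /andP[_ b] := half_log_series_bounds n (gram_norm_lt1 z12).
rewrite sphere_kernelE//; set k := (if _ then _ else _).
have -> : maxe k%:E 0%E = (Num.max k 0)%:E by rewrite EFin_max.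
rewrite -EFinM -EFinD lee_fin.
have km : k <= Num.max k 0 by rewrite le_max lexx.
have m0 : 0 <= Num.max k 0 by rewrite le_max lexx orbT.
rewrite /truncated_kernel; move: @k km m0; case: ifPn => [/eqP ->|_] k km m0.
  by rewrite expR0 mul1r (le_trans b)// lerD2r.
apply: (@le_trans _ _ (expR s * k)); last first.
  by rewrite (@le_trans _ _ (expR s * Num.max k 0)) ?lerDl// ler_wpM2l ?expR_ge0.
by rewrite /k -expRD ler_expR (le_trans (ler_wpM2l s0 b))// mulrDr mulr1 addrC.
Qed.

Local Lemma truncated_kernel_cvg z : (S n z)%:E @[n --> \oo] --> K z.
Proof.
have [z12|z12] := eqVneq z.1 z.2.
  rewrite sphere_kernel_diag//; apply/cvgeryP.
  have Ly : L n z @[n --> \oo] --> +oo.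
    by rewrite /L gram_eq1//; exact: half_log_series1_cvg.
  rewrite /truncated_kernel; case: (eqVneq s 0) => // s1.
  have sp : 0 < s by rewrite lt_neqAle eq_sym s1.
  apply/cvgryPge => A; move/cvgryPge: Ly => /(_ (A / s)).
  apply: filterS => n; rewrite ler_pdivrMr// => h.
  by rewrite (le_trans _ (expR_ge1Dx _))// mulrC (le_trans h)// lerDr.
rewrite sphere_kernelE//; apply: cvg_EFin; first exact: nearW.
have Lc := half_log_series_cvg (gram_norm_lt1 z12).
rewrite /truncated_kernel; case: (s == 0) => //.
apply: (@cvg_comp _ _ _ (fun n => s * L n z) (@expR R)); last exact: continuous_expR.
exact: cvgMr.
Qed.

Section Energy.
Variables mu nu : {finite_measure set T -> \bar R}.

(** The lower bound that carries strictness: c stands for the coefficient of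
    a square that splits off from the truncated logarithm. *)
Local Lemma truncated_kernel_energy_ge n h c : bounded_measurable h -> 0 <= c ->
  feature_kernel (fun z => L n z - c * (h z.1 * h z.2)) ->
  (if s == 0 then c else s * c) * signed_integral mu nu h ^+ 2
    <= signed_energy mu nu (S n).
Proof.
move=> bh c0 kL; have kf := feature_kernel_half_log n.
rewrite /truncated_kernel; case: (s == 0).
  have <- : signed_energy mu nu
      (fun z => (L n z - c * (h z.1 * h z.2)) + c * (h z.1 * h z.2)) =
    signed_energy mu nu (fun z => L n z).
    by congr signed_energy; apply/funext => z; rewrite subrK.
  rewrite signed_energyD ?signed_energyZ ?signed_energy_tensor//.
  - by rewrite lerDr signed_energy_feature_kernel.
  - exact: bounded_measurable_tensor.
  - exact: feature_kernel_bounded_measurable.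
  - by apply: bounded_measurableZ; exact: bounded_measurable_tensor.
apply: (@signed_energy_expR _ _ _ _ _ (fun z => s * L n z)) => //.
- exact: feature_kernelZ.
- exact: mulr_ge0.
have := feature_kernelZ s0 kL.
by under eq_fun do rewrite mulrBr mulrA.
Qed.

Local Lemma truncated_kernel_energy_ge0 n : 0 <= signed_energy mu nu (S n).
Proof.
apply: le_trans (@truncated_kernel_energy_ge n (fun=> 0) 0
  (bounded_measurable_cst _ _) (lexx 0) _).
  by case: (s == 0); rewrite ?mulr0 mul0r.
by under eq_fun do rewrite mul0r subr0; exact: feature_kernel_half_log.
Qed.

Local Lemma truncated_kernel_energy_limit_ge l :
  signed_energy mu nu (S n) @[n --> \oo] --> l -> 0 <= l.
Proof.
move=> Sl; rewrite -(cvg_lim _ Sl)//; apply: limr_ge; first exact: cvgP Sl.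
by apply: nearW => n; exact: truncated_kernel_energy_ge0.
Qed.

(** The square of each moment of positive degree, times a positive constant,
    is eventually below the energies of the truncations, which tend to 0. The
    moment of degree 0 is a combination of moments of degree 1. *)
Local Lemma signed_moments_eq0 :
  signed_energy mu nu (S n) @[n --> \oo] --> (0 : R) ->
  forall w, signed_integral mu nu (mono w) = 0.
Proof.
move=> Sl.
have bm w := bounded_measurable_monomial mphi coordinate_le1 w.
have nonempty i w : signed_integral mu nu (mono (i :: w)) = 0.
  pose c : R := (size w).+1%:R^-1 / 2.
  have c0 : 0 < c by rewrite mulr_gt0// invr_gt0.
  pose c' := if s == 0 then c else s * c.
  have c'0 : 0 < c'.
    rewrite /c'; case: (eqVneq s 0) => // s1.
    by rewrite mulr_gt0// lt_neqAle eq_sym s1.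
  have : c' * signed_integral mu nu (mono (i :: w)) ^+ 2 <= 0.
    rewrite -(cvg_lim _ Sl)//; apply: limr_ge; first exact: cvgP Sl.
    (* The square splits off once the truncation reaches the degree of i :: w. *)
    near=> n; apply: truncated_kernel_energy_ge => //; first exact: ltW.
    apply: feature_kernel_half_log_sub.
    by near: n; exact: nbhs_infty_gt.
  rewrite pmulr_rle0// => q; apply/eqP; rewrite -sqrf_eq0.
  by rewrite eq_le q sqr_ge0.
case=> [|i w]; last exact: nonempty.
rewrite (_ : mono [::] = fun x => \sum_(i <- enum I) a i * mono [:: i] x); last first.
  apply/funext => x; rewrite big_enum/= /monomial big_nil.
  by under eq_bigr do rewrite big_seq1; rewrite phi_hyperplane.
elim: (enum I) => [|i e IH].
  under eq_fun do rewrite big_nil.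
  have /= := signed_integralZ mu nu 0 (bounded_measurable_cst T (0 : R)).
  by under eq_fun do rewrite mul0r; rewrite mul0r.
under eq_fun do rewrite big_cons.
rewrite signed_integralD ?IH ?signed_integralZ ?nonempty ?mulr0 ?addr0//.
  exact: bounded_measurableZ.
by apply: bounded_measurable_sum => j; exact: bounded_measurableZ.
Unshelve. all: by end_near. Qed.

End Energy.

(** An infinite positive part makes the energy infinite, since the energy is
    well defined; otherwise the energy is the limit of the energies of the
    truncations. *)
Theorem sphere_kernel_strictly_positive_definite :
  strictly_positive_definite sphere_kernel.
Proof.
have lim nu := signed_energy_limit truncated_kernel_bounded truncated_kernel_geN1
  truncated_kernel_le truncated_kernel_cvg (expR_ge0 s) ler01
  (fun n => truncated_kernel_energy_ge0 (pos_part nu) (neg_part nu) n).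
have posE nu : energy_defined sphere_kernel nu ->
    energy_pos sphere_kernel nu = +oo%E -> energy sphere_kernel nu = +oo%E.
  move=> def py; rewrite /energy py addye//; apply/eqP => e.
  by apply: def; split=> //; move: e; case: (energy_neg _ _).
split=> [nu def|nu def e0 A mA].
  have [py|] := eqVneq (energy_pos sphere_kernel nu) +oo%E.
    by rewrite posE// leey.
  rewrite -ltey => /lim[pf nf Sl].
  rewrite /energy -[energy_pos _ _]fineK// -[energy_neg _ _]fineK// -EFinB lee_fin.
  exact: truncated_kernel_energy_limit_ge Sl.
have [py|] := eqVneq (energy_pos sphere_kernel nu) +oo%E.
  by move: e0; rewrite posE.
rewrite -ltey => /lim[pf nf Sl].
have l0 : fine (energy_pos sphere_kernel nu) - fine (energy_neg sphere_kernel nu) = 0.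
  move: e0; rewrite /energy -[energy_pos _ _]fineK// -[energy_neg _ _]fineK// -EFinB.
  by case.
rewrite l0 in Sl.
have := moments_determine_measure mphi coordinate_le1 (signed_moments_eq0 Sl)
  phi_generates mA.
rewrite (jordan_decomp (hahn_posneg nu) mA) /cadd /= cscaleN1 => e.
have eJ : jordan_pos (hahn_posneg nu) A = jordan_neg (hahn_posneg nu) A by exact: e.
by rewrite eJ subee// (fin_num_measure (neg_part nu)).
Qed.

End RieszKernelOnSphere.

(** * Projective spaces as subsets of a sphere *)

Section CayleyDicksonCoordinates.
Variable R : realType.

Fixpoint cd_index (k : nat) : finType :=
  match k with
  | 0 => unit
  | k'.+1 => (cd_index k' + cd_index k')%type
  end.

Fixpoint cd_coord (k : nat) : cd_index k -> cd R k -> R :=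
  match k return cd_index k -> cd R k -> R with
  | 0 => fun _ x => x
  | k'.+1 => fun i x =>
      match i with inl j => cd_coord j x.1 | inr j => cd_coord j x.2 end
  end.

Lemma cd_coord_inj k (x y : cd R k) :
  (forall i, cd_coord i x = cd_coord i y) -> x = y.
Proof.
elim: k x y => [|k IH] x y xy; first exact: xy tt.
case: x y xy => [x1 x2] [y1 y2] xy; congr pair; apply: IH => i.
  exact: xy (inl i).
exact: xy (inr i).
Qed.

Lemma cd_coord0 k (i : cd_index k) : cd_coord i 0 = 0.
Proof. by elim: k i => [|k IH] [] //= i; exact: IH. Qed.

Lemma cd_conjN k (x : cd R k) : cd_conj (- x) = - cd_conj x.
Proof. by elim: k x => [|k IH] //= x; rewrite IH. Qed.

Lemma cd_mulN k (x y : cd R k) :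
  cd_mul (- x) y = - cd_mul x y /\ cd_mul x (- y) = - cd_mul x y.
Proof.
elim: k x y => [|k IH] x y; first by split; [exact: mulNr|exact: mulrN].
have l u v := (IH u v).1; have r u v := (IH u v).2.
split; rewrite /= ?cd_conjN !l !r; congr pair; rewrite ?opprD ?opprK//.
Qed.

Lemma cd_reD k : {morph @cd_re R k : x y / x + y}.
Proof. by elim: k => [|k IH] //= x y; rewrite IH. Qed.

Lemma cd_re0 k : cd_re (0 : cd R k) = 0.
Proof. by elim: k. Qed.

(** The real part of x times the conjugate of y is the Euclidean inner
    product of the coordinates, at every level of the doubling. The product of
    level k + 1 mixes the two orders of conjugation, so both are treated
    together. *)
Lemma cd_re_mul_conj k (x y : cd R k) :
  cd_re (cd_mul x (cd_conj y)) = \sum_i cd_coord i x * cd_coord i y /\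
  cd_re (cd_mul (cd_conj x) y) = \sum_i cd_coord i x * cd_coord i y.
Proof.
elim: k x y => [|k IH] x y; first by rewrite /= (big_pred1 tt)//; case.
have l u v := (IH u v).1; have r u v := (IH u v).2.
rewrite big_sumType/= cd_conjN (cd_mulN _ _).1 (cd_mulN _ _).2 !opprK.
rewrite !cd_reD l !r; split; congr (_ + _);
  by apply: eq_bigr => i _; rewrite mulrC.
Qed.

(** Weighting the coordinates by those of 1 makes the real part a linear
    form in the coordinates without naming the index of the real axis. *)
Lemma cd_re_coord k (x : cd R k) :
  cd_re x = \sum_i cd_coord i (cd_one R k) * cd_coord i x.
Proof.
elim: k x => [|k IH] x; first by rewrite /= (big_pred1 tt) ?mul1r//; case.
rewrite big_sumType/= -IH [X in _ + X]big1 ?addr0// => i _.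
by rewrite cd_coord0 mul0r.
Qed.

(** The product topology comes with the sup norm, so that balls are cubes in
    the coordinates. *)
Lemma cd_coord_ball k (x y : cd R k) (e : R) : 0 < e ->
  ball x e y <-> forall i, `|cd_coord i x - cd_coord i y| < e.
Proof.
move=> e0; elim: k x y => [|k IH] x y.
  by split=> [xy i|xy]; [exact: xy|exact: xy tt].
split=> [[/IH b1 /IH b2] [i|i]|b]; [exact: b1|exact: b2|].
split; apply/IH => i; first exact: b (inl i).
exact: b (inr i).
Qed.

End CayleyDicksonCoordinates.

Section ProjspaceCoordinates.
Variables (R : realType) (F : division_algebra) (n : nat).

Local Notation k := (cd_level F).
Local Notation P := (projspace R F n).

Definition projspace_index : finType := ('I_n.+1 * 'I_n.+1 * cd_index k)%type.

Definition projspace_coord (i : projspace_index) (x : borel_projspace R F n) : R :=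
  cd_coord i.2 ((set_val x : 'M[alg R F]_n.+1) i.1.1 i.1.2).

Lemma mxdot_coord (x y : borel_projspace R F n) :
  mxdot (set_val x) (set_val y) = \sum_i projspace_coord i x * projspace_coord i y.
Proof.
rewrite /mxdot (big_morph _ (@cd_reD R k) (cd_re0 R k)).
under eq_bigr do rewrite (big_morph _ (@cd_reD R k) (cd_re0 R k)).
under eq_bigr => i _ do under eq_bigr => j _ do rewrite (cd_re_mul_conj _ _).1.
by rewrite pair_big/= pair_big/=.
Qed.

(** For a Hermitian idempotent, <x, x> = Re tr (x x) = Re tr x = 1. *)
Lemma mxdot_projector (x : borel_projspace R F n) :
  mxdot (set_val x) (set_val x) = 1.
Proof.
have [xh xx tx] := set_valP x.
have xc i j : cd_conj ((set_val x : 'M[alg R F]_n.+1) i j) =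
    (set_val x : 'M[alg R F]_n.+1) j i.
  by have /matrixP/(_ j i) := xh; rewrite mxE.
rewrite /mxdot; under eq_bigr => i _ do under eq_bigr => j _ do rewrite xc.
rewrite (_ : \sum_i _ = \tr (alg_mulmx (set_val x : 'M[alg R F]_n.+1) (set_val x))).
  by rewrite xx tx; elim: (cd_level F).
by apply: eq_bigr => i _; rewrite mxE.
Qed.

Lemma projspace_coord_sphere (x : borel_projspace R F n) :
  \sum_i projspace_coord i x ^+ 2 = 1.
Proof.
rewrite -(mxdot_projector x) mxdot_coord.
by apply: eq_bigr => i _; rewrite expr2.
Qed.

Definition trace_weight (i : projspace_index) : R :=
  if i.1.1 == i.1.2 then cd_coord i.2 (cd_one R k) else 0.

Lemma projspace_coord_trace (x : borel_projspace R F n) :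
  \sum_i trace_weight i * projspace_coord i x = 1.
Proof.
have [_ _ tx] := set_valP x.
transitivity (cd_re (\tr (set_val x : 'M[alg R F]_n.+1))); last first.
  by rewrite tx; elim: (cd_level F).
rewrite /mxtrace (big_morph _ (@cd_reD R k) (cd_re0 R k)).
rewrite (eq_bigr (fun i => (trace_weight (i.1, i.2) *
  projspace_coord (i.1, i.2) x))); last by case.
rewrite -(pair_big xpredT xpredT (fun i j => trace_weight (i, j) *
  projspace_coord (i, j) x))/=.
rewrite (eq_bigr (fun i : 'I_n.+1 * 'I_n.+1 => if i.1 == i.2 then
  cd_re ((set_val x : 'M[alg R F]_n.+1) i.1 i.2) else 0)); last first.
  case=> i j _ /=; rewrite /trace_weight/=; case: (i == j).
    by rewrite cd_re_coord.
  by rewrite big1// => l _; rewrite mul0r.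
rewrite -(pair_big xpredT xpredT (fun i j : 'I_n.+1 => if i == j then
  cd_re ((set_val x : 'M[alg R F]_n.+1) i j) else 0))/=.
apply: eq_bigr => i _; rewrite (bigD1 i)//= eqxx big1 ?addr0// => j ji.
by rewrite eq_sym (negbTE ji).
Qed.

Lemma projspace_coord_inj (x y : borel_projspace R F n) :
  (forall i, projspace_coord i x = projspace_coord i y) -> x = y.
Proof.
move=> xy; apply: val_inj; apply/matrixP => i j; apply: cd_coord_inj => l.
exact: xy (i, j, l).
Qed.

Lemma projspace_open_box (U : set P) (x : P) : open U -> U x ->
  exists2 e : R, 0 < e & forall y : P,
    (forall i, `|projspace_coord i x - projspace_coord i y| < e) -> U y.
Proof.
case=> V oV <- Vx.
have /nbhs_ballP[e e0 eV] : nbhs (set_val x : 'M[alg R F]_n.+1) V.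
  by apply: open_nbhs_nbhs; split.
exists e => // y xy; apply: eV; split => // i j.
by apply/cd_coord_ball => // l; exact: xy (i, j, l).
Qed.

Lemma projspace_coord_open i b : open [set x : P | b < projspace_coord i x].
Proof.
exists [set M : 'M[alg R F]_n.+1 | b < cd_coord i.2 (M i.1.1 i.1.2)] => //.
rewrite openE => M /= bM; apply/nbhs_ballP.
exists (cd_coord i.2 (M i.1.1 i.1.2) - b); first by rewrite /= subr_gt0.
move=> N [e0 /(_ i.1.1 i.1.2) /(cd_coord_ball _ _ e0) /(_ i.2)] /=.
rewrite ltr_norml; lra.
Qed.

Lemma projspace_coord_measurable i : measurable_fun setT (projspace_coord i).
Proof.
apply: (measurability _ (RGenOInfty.measurableE R)) => //.
move=> _ [_ [b ->] <-]; rewrite setTI.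
apply: sub_sigma_algebra; rewrite (_ : _ @^-1` _ = [set x : P | b < projspace_coord i x]).
  exact: projspace_coord_open.
by apply/seteqP; split=> x /=; rewrite in_itv/= andbT.
Qed.

(** Each open set is the union of the cubes with rational center and radius
    that it contains, and there are countably many of them. *)
Lemma projspace_borel_generated (G : set (set (borel_projspace R F n))) :
  sigma_algebra setT G ->
  (forall i b, G [set x | b < projspace_coord i x]) -> measurable `<=` G.
Proof.
move=> sG Gi; apply: smallest_sub => // U oU.
pose T := g_sigma_algebraType G.
suff : measurable (U : set T).
  by move=> mU; have <- := sigma_algebra_id sG; exact: mU.
have mi i : measurable_fun [set: T] (projspace_coord i).
  apply: (measurability _ (RGenOInfty.measurableE R)) => //.
  move=> _ [_ [b ->] <-]; rewrite setTI; apply: sub_sigma_algebra.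
  rewrite (_ : _ @^-1` _ = [set x | b < projspace_coord i x]); first exact: Gi.
  by apply/seteqP; split=> x /=; rewrite in_itv/= andbT.
pose box (q : {ffun projspace_index -> rat} * rat) : set T :=
  \bigcap_(i in [set: projspace_index])
    projspace_coord i @^-1` ball (ratr (q.1 i) : R) (ratr q.2).
have mbox q : measurable (box q).
  apply: fin_bigcap_measurable; first exact: finite_finset.
  move=> i _; rewrite -[_ @^-1` _]setTI; apply: mi => //.
  exact: measurable_ball.
have -> : U = \bigcup_(q in [set q | box q `<=` U]) box q.
  apply/seteqP; split=> [x Ux|x [q qU]]; last exact: qU.
  have [e e0 eU] := projspace_open_box oU Ux.
  (* A cube of radius below e / 2 that contains x lies in the cube of radius e
     around x. *)
  have e2 : 0 < e / 2 by rewrite divr_gt0.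
  have [r] := rat_in_itvoo e2; rewrite in_itv/= => /andP[r0 re].
  have /choice[q qx] i : exists q : rat, `|projspace_coord i x - ratr q| < ratr r.
    have xr : projspace_coord i x - ratr r < projspace_coord i x + ratr r.
      by rewrite ltrD2l gtrN.
    have [q] := rat_in_itvoo xr; rewrite in_itv/= => /andP[q1 q2].
    exists q; rewrite distrC ltr_norml.
    by rewrite ltrBlDl q2 andbT ltrBrDl q1.
  exists ([ffun i => q i], r).
    move=> y yb; apply: eU => i; have := yb i I; have := qx i.
    rewrite /= ffunE /ball/= => h1 h2.
    rewrite (_ : _ - _ = (projspace_coord i x - ratr (q i)) +
       (ratr (q i) - projspace_coord i y)); last by ring.
    rewrite (le_lt_trans (ler_normD _ _))// (splitr e) ltrD//.
      exact: lt_trans re.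
    exact: lt_trans re.
  by move=> i _; rewrite /= ffunE /ball/= distrC.
rewrite bigcup_mkcond; apply: countable_bigcupT_measurable => [|q].
  exact: countableP.
by case: ifP.
Qed.

End ProjspaceCoordinates.

Lemma riesz_kernelE (R : realType) (F : division_algebra) (n : nat) (s : R) :
  @riesz_kernel R F n s = sphere_kernel (@projspace_coord R F n) s.
Proof.
apply/funext => x; apply/funext => y.
by rewrite /riesz_kernel /sphere_kernel /chordal /gram mxdot_coord.
Qed.

Local Close Scope classical_set_scope.

Theorem theorem2p18 (R : realType) (F : division_algebra) (d : nat)
    (hd : (3 <= d)%N) (hO : F = Octonions -> d = 3%N)
    (s : R) (hs0 : 0 <= s) (hsD : s < ((d - 1) * dimR F)%N%:R) :
  strictly_positive_definite (@riesz_kernel R F (d - 1) s).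
Proof.
rewrite riesz_kernelE.
exact: (sphere_kernel_strictly_positive_definite
  (@projspace_coord_measurable R F (d - 1)) (@projspace_coord_sphere R F (d - 1))
  (@projspace_coord_inj R F (d - 1)) (@projspace_coord_trace R F (d - 1))
  (@projspace_borel_generated R F (d - 1)) hs0).
Qed.
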